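(* For every $n\geq 5$ there exists a periodic triangulation of $\mathbb{Z}^n$ that is not regular.
   Context: A periodic triangulation of $\mathbb{Z}^n$ is a collection $\mathcal{T}$ of $n$-dimensional simplices in $\mathbb{R}^n$ whose set of vertices is $\mathbb{Z}^n$, which cover $\mathbb{R}^n$, such that the intersection of any two simplices of $\mathcal{T}$ is a (possibly empty) face of both, and such that $\mathcal{T}+v=\mathcal{T}$ for every $v\in\mathbb{Z}^n$. A triangulation $\mathcal{T}$ of $\mathbb{Z}^n$ is regular if there exists a function $f:\mathbb{Z}^n\to\mathbb{R}$ (not assumed to have any periodicity) such that the points $(x,f(x))$, $x\in\mathbb{Z}^n$, are vertices of the convex polyhedron $H(f)=\mathrm{conv}\{(x,f(x)) : x\in\mathbb{Z}^n\}\subset\mathbb{R}^{n+1}$, and the simplices of $\mathcal{T}$ are the orthogonal projections onto $\mathbb{R}^n$ of the facets of $H(f)$. *)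

(* Defs.v *)
From mathcomp Require Import all_boot all_order all_algebra.
From mathcomp Require Import boolp classical_sets reals convex.

Set Implicit Arguments.
Unset Strict Implicit.
Unset Printing Implicit Defensive.

Import Order.TTheory GRing.Theory Num.Theory.
Local Open Scope classical_set_scope.
Local Open Scope ring_scope.

Section ConvexGeometry.
Context {R : realType} {V : lmodType R}.
Implicit Types (A C F S : set V).

Definition convex_hull A : set V := smallest (@convex_set R V) A.

Definition affinely_independent k (p : 'I_k -> V) : Prop :=
  forall c : 'I_k -> R,
    \sum_i c i = 0 -> \sum_i c i *: p i = 0 -> forall i, c i = 0.

(* The affine rank is one more than the affine dimension, so that the empty
   set has rank 0. *)
Definition has_affine_rank S (k : nat) : Prop :=
  (exists2 p : 'I_k -> V, affinely_independent p & forall i, S (p i)) /\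
  (forall p : 'I_k.+1 -> V, (forall i, S (p i)) -> ~ affinely_independent p).

(* The linear form [l] may be zero: set0 and C itself are faces of C. *)
Definition face C F : Prop :=
  exists (l : {scalar V}) (b : R),
    (forall x, C x -> l x <= b) /\ F = C `&` [set x | l x = b].

Definition vertices C : set V := [set v | face C [set v]].

(* Faces of codimension one in the affine hull of C. *)
Definition facets C : set (set V) :=
  [set F | face C F /\ exists k, has_affine_rank F k /\ has_affine_rank C k.+1].

Definition translate (v : V) S : set V := [set v + x | x in S].

End ConvexGeometry.

Section Triangulations.
Context {R : realType} {n : nat}.

Definition lattice_point (z : 'rV[int]_n) : 'rV[R]_n := map_mx intr z.

Definition is_simplex (s : set 'rV[R]_n) : Prop :=
  exists2 p : 'I_n.+1 -> 'rV[R]_n,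
    affinely_independent p & s = convex_hull (range p).

Record periodic_triangulation (T : set (set 'rV[R]_n)) : Prop :=
  PeriodicTriangulation {
    triang_simplex : forall s, T s -> is_simplex s;
    triang_vertices : \bigcup_(s in T) vertices s = range lattice_point;
    triang_cover : \bigcup_(s in T) s = setT;
    triang_face_to_face :
      forall s t, T s -> T t -> face s (s `&` t) /\ face t (s `&` t);
    triang_periodic :
      forall z, [set translate (lattice_point z) s | s in T] = T
  }.

Definition lifted_point (f : 'rV[int]_n -> R) (z : 'rV[int]_n) :
    'rV[R]_(n + 1) :=
  row_mx (lattice_point z) (f z)%:M.

Definition lifted_hull (f : 'rV[int]_n -> R) : set 'rV[R]_(n + 1) :=
  convex_hull (range (lifted_point f)).

Definition vertical_proj (x : 'rV[R]_(n + 1)) : 'rV[R]_n := lsubmx x.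

Definition regular_triangulation (T : set (set 'rV[R]_n)) : Prop :=
  exists f : 'rV[int]_n -> R,
    (forall z, vertices (lifted_hull f) (lifted_point f z)) /\
    T = [set vertical_proj @` F | F in facets (lifted_hull f)].

End Triangulations.

(* Main.v *)
(** A triangulation of Z^n is encoded by ordered vertex lists, so that its edges
    are oriented.  Given such a triangulation K, the prisms over its simplices
    are cut into simplices by the staircase rule, the square over an edge
    u -> v receiving the diagonal (u, m) -- (v, m + 1); this is again a
    periodic triangulation, in one more dimension.  If it were regular with
    height function f, then f(v, 1) - f(v, 0) would be strictly monotone along
    every oriented edge of K.  So it suffices to find a K whose edges contain an
    oriented cycle although every simplex is oriented acyclically.

    In Z^4 this happens for the Delaunay triangulation of Voronoi's third type:
    it has 24 simplices modulo translation, all in the unit cube, and three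
    pairwise adjacent vertices that do not span a triangle.  It is certified to
    be a triangulation by quadratic functions, one for each simplex, that are
    nonnegative on Z^4, vanish exactly at the vertices of the simplex, and
    differ from one another by affine functions.  The cycle survives in all the
    iterated prisms, which gives every dimension at least 5. *)
From HB Require Import structures.
Require Import Defs.
From mathcomp Require Import all_boot all_order all_algebra.
From mathcomp Require Import boolp classical_sets reals convex.
From mathcomp Require Import interval_inference ring lra zify.

Set Implicit Arguments.
Unset Strict Implicit.
Unset Printing Implicit Defensive.

Import Order.TTheory GRing.Theory Num.Theory.
Local Open Scope classical_set_scope.
Local Open Scope ring_scope.

(** * Ordered triangulations *)

Section WeightedLists.
Context {R : realType} {n : nat}.
Implicit Types (v z : 'rV[int]_n) (w : seq ('rV[int]_n * R)) (x : 'rV[R]_n).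
Implicit Types (K : seq 'rV[int]_n -> Prop).

Definition mass w : R := \sum_(p <- w) p.2.

Definition barycenter w : 'rV[R]_n := \sum_(p <- w) p.2 *: lattice_point p.1.

Definition positive w := all (fun p => 0 < p.2) w.

(** The weights are strictly positive, so [w] lists exactly the vertices of the simplex having [x]
    in its relative interior. Uniqueness of [w] therefore encodes affine independence and the
    face-to-face condition at once. *)
Definition represents K x w : Prop :=
  [/\ K (unzip1 w), positive w, mass w = 1 & barycenter w = x].

(* A periodic triangulation of Z^n given by the vertex lists of its simplices
   of all dimensions; listing the vertices of each simplex in a definite order
   orients the edges. *)
Record ordered_triangulation K : Prop := OrderedTriangulation {
  ot_sub : forall s s', subseq s s' -> K s' -> K s;
  ot_translate : forall z s, K s -> K [seq z + v | v <- s];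
  ot_single : forall z, K [:: z];
  ot_pure : forall s, K s ->
    exists s', [/\ K s', subseq s s' & size s' = n.+1];
  ot_cover : forall x, exists w, represents K x w;
  ot_unique : forall x w w', represents K x w -> represents K x w' -> w = w' }.

(** The three edges may come from different simplices; inside a single one the list order excludes a
    cycle. *)
Definition cyclic_triangle K : Prop :=
  exists u v t, [/\ K [:: u; v], K [:: v; t] & K [:: t; u]].

Lemma mass_nil : mass [::] = 0. Proof. exact: big_nil. Qed.

Lemma mass_cons p w : mass (p :: w) = p.2 + mass w.
Proof. exact: big_cons. Qed.

Lemma mass_ge0 w : positive w -> 0 <= mass w.
Proof.
elim: w => [|p w IH] /=; first by rewrite mass_nil.
by case/andP=> p0 /IH w0; rewrite mass_cons addr_ge0 // ltW.
Qed.

Lemma mass_eq0 w : positive w -> mass w = 0 -> w = [::].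
Proof.
case: w => [//|p w] /= /andP[p0 /mass_ge0 w0]; rewrite mass_cons => /eqP.
by rewrite gt_eqF // ltr_pwDl.
Qed.

Lemma barycenter_nil : barycenter [::] = 0. Proof. exact: big_nil. Qed.

Lemma barycenter_cons p w :
  barycenter (p :: w) = p.2 *: lattice_point p.1 + barycenter w.
Proof. exact: big_cons. Qed.

End WeightedLists.

(** * Staircases over an ordered simplex *)

Section Glue.
Context {T : eqType}.
Implicit Types (v : T) (s : seq T).

(* The lower part s1 and the upper part s2 of a staircase over the simplex s
   may have one vertex of s in common. *)
Inductive glued : seq T -> seq T -> seq T -> Prop :=
| glued_nil s : glued [::] s s
| glued_share v s : glued [:: v] (v :: s) (v :: s)
| glued_cons v s1 s2 s : glued s1 s2 s -> glued (v :: s1) s2 (v :: s).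

Lemma subseq_cons2 v u s s' : subseq (v :: s) (u :: s') ->
  v = u /\ subseq s s' \/ subseq (v :: s) s'.
Proof. by rewrite [subseq _ _]/=; case: eqP => [->|_]; [left | right]. Qed.

Lemma subseq_seq1 v s : subseq s [:: v] -> s = [::] \/ s = [:: v].
Proof.
case: s => [|u s]; first by left.
by case/subseq_cons2=> [[-> /eqP->]|//]; right.
Qed.

Lemma glued_nilr s : glued s [::] s.
Proof. by elim: s => [|v s IH]; constructor. Qed.

(** This makes prisms closed under taking faces. *)
Lemma glued_subseq s1 s2 s s1' s2' :
  glued s1 s2 s -> subseq s1' s1 -> subseq s2' s2 ->
  exists2 s', subseq s' s & glued s1' s2' s'.
Proof.
move=> g; elim: g s1' s2' => {s1 s2 s} [s|v s|v s1 s2 s g IH] s1' s2'.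
- by rewrite subseq0 => /eqP-> sub; exists s2' => //; constructor.
- case/subseq_seq1=> -> sub; first by exists s2' => //; constructor.
  case: s2' sub => [_|t s2' /subseq_cons2[[-> sub]|sub]].
  + exists [:: v]; last exact: glued_nilr.
    by rewrite /= eqxx sub0seq.
  + by exists (v :: s2'); [rewrite /= eqxx | constructor].
  + by exists (v :: t :: s2'); [rewrite /= eqxx | do 2 constructor].
- have skip : subseq s1' s1 -> subseq s2' s2 ->
      exists2 s', subseq s' (v :: s) & glued s1' s2' s'.
    move=> sub1 sub2; have [s' sub' g'] := IH _ _ sub1 sub2.
    by exists s' => //; apply: subseq_trans sub' (subseq_cons _ _).
  case: s1' skip => [|u s1'] skip; first by move=> _; apply/skip/sub0seq.
  case/subseq_cons2=> [[-> sub1] sub2|]; last exact: skip.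
  have [s' sub' g'] := IH _ _ sub1 sub2.
  by exists (v :: s'); [rewrite /= eqxx | constructor].
Qed.

(** This makes prisms pure: a maximal staircase has a shared vertex, hence one vertex more than the
    simplex below it. *)
Lemma glued_extend s1 s2 s s' :
  glued s1 s2 s -> subseq s s' -> (0 < size s')%N ->
  exists s1' s2', [/\ glued s1' s2' s', subseq s1 s1', subseq s2 s2' &
    (size s1' + size s2' = (size s').+1)%N].
Proof.
elim: s' s1 s2 s => [//|v s' IH] s1 s2 s g sub _.
(* Completion that changes level at the head [v], which then belongs to both parts. *)
have share a b : a = [::] \/ a = [:: v] -> subseq b (v :: s') ->
    exists s1' s2', [/\ glued s1' s2' (v :: s'), subseq a s1', subseq b s2' &
      (size s1' + size s2' = (size (v :: s')).+1)%N].
  move=> a0 bs; exists [:: v], (v :: s'); split=> //; first exact: glued_share.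
  by case: a0 => ->; rewrite /= ?eqxx.
case: s' IH sub share => [_ sub share|u s' IH sub share].
  case: g sub => [t|t b|t a b c g].
  - by move=> tv; apply: share; [left|].
  - by case/subseq_cons2=> [[-> /eqP->]|//]; apply: share; [right|rewrite /= eqxx].
  - case/subseq_cons2=> [[-> /eqP c0]|//]; move: g; rewrite c0 => g.
    inversion g; subst; apply: share; [by right|exact: sub0seq].
(* Completion that puts [v] in the lower part and treats the rest by induction. *)
have skip a b c : glued a b c -> subseq c (u :: s') ->
    forall a', subseq a' (v :: a) -> 
    exists s1' s2', [/\ glued s1' s2' (v :: u :: s'), subseq a' s1',
      subseq b s2' & (size s1' + size s2' = (size (v :: u :: s')).+1)%N].
  move=> g' sub' a' suba; have [//|s1' [s2' [g'' sub1 sub2 sz]]] := IH _ _ _ g' sub'.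
  exists (v :: s1'), s2'; split => //; first exact: glued_cons.
    by apply: subseq_trans suba _; rewrite /= eqxx.
  by rewrite /= addSn sz.
case: g sub => [t|t b|t a b c g] sub.
- by apply: share; [left|].
- case/subseq_cons2: sub => [[-> sub]|sub].
    by apply: share; [right|rewrite /= eqxx].
  apply: (skip [:: t] (t :: b) (t :: b)) => //; first exact: glued_share.
  exact: subseq_cons.
- case/subseq_cons2: sub => [[-> sub]|sub].
    by apply: (skip _ _ _ g) => //=; rewrite eqxx.
  apply: (skip (t :: a) b (t :: c)) => //; first exact: glued_cons.
  exact: subseq_cons.
Qed.

End Glue.

Lemma glued_map (T T' : eqType) (f : T -> T') s1 s2 s :
  glued s1 s2 s -> glued (map f s1) (map f s2) (map f s).
Proof. by elim => [t|t b|t a b c _ IH] /=; constructor. Qed.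

(** * Distribution of barycentric weights over a staircase *)

Section WeightedGlue.
Context {R : realType} {n : nat}.
Implicit Types (w : seq ('rV[int]_n * R)).

Inductive wglued : seq ('rV[int]_n * R) -> seq ('rV[int]_n * R) ->
    seq ('rV[int]_n * R) -> Prop :=
| wglued_nil w : wglued [::] w w
| wglued_share v a b w : wglued [:: (v, a)] ((v, b) :: w) ((v, a + b) :: w)
| wglued_cons p w1 w2 w : wglued w1 w2 w -> wglued (p :: w1) w2 (p :: w).

Lemma wglued_nilr w : wglued w [::] w.
Proof. by elim: w => [|p w IH]; constructor. Qed.

Lemma wglued_unzip1 w1 w2 w :
  wglued w1 w2 w -> glued (unzip1 w1) (unzip1 w2) (unzip1 w).
Proof. by elim => [t|v a b t|p a b t _ IH] /=; constructor. Qed.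

Lemma wglued_exists w1 w2 s : glued (unzip1 w1) (unzip1 w2) s ->
  exists2 w, wglued w1 w2 w & unzip1 w = s.
Proof.
move Es1: (unzip1 w1) => s1; move Es2: (unzip1 w2) => s2 g.
elim: g w1 w2 Es1 Es2 => {s1 s2 s} [s|v s|v s1 s2 s g IH] w1 w2.
- by case: w1 => // _ <-; exists w2 => //; constructor.
- case: w1 => // -[u a] [|//] [->]; case: w2 => // -[t b] w2 [-> <-].
  by exists ((v, a + b) :: w2) => //; constructor.
- case: w1 => // -[u a] w1 [-> Es1] Es2; have [w g' Ew] := IH _ _ Es1 Es2.
  by exists ((v, a) :: w); [constructor | rewrite /= Ew].
Qed.

Lemma wglued_mass w1 w2 w : wglued w1 w2 w -> mass w = mass w1 + mass w2.
Proof.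
elim => [t|v a b t|p a b t _ IH]; rewrite !(mass_nil, mass_cons) /= ?IH; ring.
Qed.

Lemma wglued_barycenter w1 w2 w :
  wglued w1 w2 w -> barycenter w = barycenter w1 + barycenter w2.
Proof.
elim => [t|v a b t|p a b t _ IH];
  rewrite !(barycenter_nil, barycenter_cons) /= ?IH ?add0r ?addrA //.
by rewrite addr0 scalerDl.
Qed.

Lemma wglued_positive w1 w2 w :
  wglued w1 w2 w -> positive w1 -> positive w2 -> positive w.
Proof.
elim => [t|v a b t|p a b t _ IH] //=.
- by rewrite andbT => a0 /andP[b0 ->]; rewrite addr_gt0.
- by case/andP=> -> /IH; apply.
Qed.

(** Weight is moved to the lower part from the front of the list until its mass is [c]; a vertex
    whose weight is used only partly becomes the shared one. *)
Lemma wglued_cut w c : positive w -> 0 <= c <= mass w ->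
  exists w1 w2, [/\ wglued w1 w2 w, positive w1, positive w2 & mass w1 = c].
Proof.
elim: w c => [|[v a] w IH] c /=.
  rewrite mass_nil => _ c0; exists [::], [::]; rewrite mass_nil; split => //.
    exact: wglued_nil.
  by lra.
case/andP=> a0 pw; rewrite mass_cons /= => /andP[c0 cw].
have [->|cn0] := eqVneq c 0.
  exists [::], ((v, a) :: w); rewrite mass_nil /= a0; split => //.
  exact: wglued_nil.
have [ca|ac] := ltP c a.
  exists [:: (v, c)], ((v, a - c) :: w).
  rewrite /= mass_cons mass_nil subr_gt0 ca pw addr0 /= andbT lt0r cn0 c0.
  split => //; rewrite -[in X in wglued _ _ X](subrK c a) [a - c + c]addrC.
  exact: wglued_share.
have [//||w1 [w2 [g p1 p2 m1]]] := IH (c - a); first by lra.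
exists ((v, a) :: w1), w2; rewrite /= a0 p1 p2; split => //.
  exact: wglued_cons.
by rewrite mass_cons m1 /=; lra.
Qed.

(** A lower part is an initial segment of [w], possibly with its last weight reduced, so with
    positive weights its mass determines the cut. *)
Lemma wglued_inj w w1 w2 w1' w2' :
  wglued w1 w2 w -> wglued w1' w2' w -> positive w1 -> positive w2 ->
  positive w1' -> positive w2' -> mass w1 = mass w1' -> w1 = w1' /\ w2 = w2'.
Proof.
move=> g; elim: g w1' w2' => {w1 w2 w} [w|v a b w|p w1 w2 w g IH] w1' w2' g'.
- move=> _ _ p1 _; rewrite mass_nil => /esym/(mass_eq0 p1) w10.
  by move: g'; rewrite w10 => g'; inversion g'.
- inversion g' as [w0|v0 a0 b0 w0 e1 e2 e3|p0 w10 w20 w0 g0 e1 e2 e3]; subst.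
  + by move=> /andP[/= a0 _] _ _ _; rewrite mass_cons !mass_nil /= => em; exfalso; lra.
  + rewrite !(mass_cons, mass_nil) /= => _ _ _ _ ea.
    have ea0 : a0 = a by lra.
    have eb0 : b0 = b by lra.
    by rewrite ea0 eb0.
  + move=> _ /andP[/= b0 _] /andP[_ /mass_ge0 m1] _.
    by rewrite !mass_cons mass_nil /= => em; exfalso; lra.
- inversion g' as [w0|v0 a0 b0 w0 e1 e2 e3|p0 w10 w20 w0 g0 e1 e2 e3]; subst.
  + by move=> /andP[/= p0 /mass_ge0 m1] _ _ _; rewrite mass_cons mass_nil => em; exfalso; lra.
  + move=> /andP[/= a1 /mass_ge0 m1] _ _ /andP[/= b1 _].
    by rewrite !mass_cons mass_nil /= => em; exfalso; lra.
  + move=> /andP[_ p1] p2 /andP[_ p1'] p2'; rewrite !mass_cons => /addrI em.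
    by have [-> ->] := IH _ _ g0 p1 p2 p1' p2' em.
Qed.

End WeightedGlue.

(** * Prisms *)

Section Prism.
Context {R : realType} {n : nat}.
Implicit Types (K : seq 'rV[int]_n -> Prop) (m : int) (v : 'rV[int]_n).
Implicit Types (w : seq ('rV[int]_n * R)).

Definition at_level m v : 'rV[int]_(n + 1) := row_mx v m%:M.

(* The staircase triangulation of (triangulation of R^n) x R, in which the
   prism over an oriented edge u -> v has the diagonal (u, m) -> (v, m + 1). *)
Definition prism K (c : seq 'rV[int]_(n + 1)) : Prop :=
  exists m s1 s2 s, [/\ K s, glued s1 s2 s &
    c = map (at_level m) s1 ++ map (at_level (m + 1)) s2].

Definition lift_weights m w : seq ('rV[int]_(n + 1) * R) :=
  [seq (at_level m p.1, p.2) | p <- w].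

Lemma at_levelD m m' v v' :
  at_level m v + at_level m' v' = at_level (m + m') (v + v').
Proof. by rewrite /at_level add_row_mx -raddfD. Qed.

Lemma at_level_inj m : injective (at_level m).
Proof. by move=> u v /(congr1 lsubmx); rewrite !row_mxKl. Qed.

Lemma lattice_point_at_level m v :
  lattice_point (at_level m v) = row_mx (lattice_point v) (m%:~R)%:M :> 'rV[R]_(n + 1).
Proof. by rewrite /lattice_point map_row_mx map_scalar_mx. Qed.

Lemma mass_cat k (w w' : seq ('rV[int]_k * R)) :
  mass (w ++ w') = mass w + mass w'.
Proof. exact: big_cat. Qed.

Lemma barycenter_cat k (w w' : seq ('rV[int]_k * R)) :
  barycenter (w ++ w') = barycenter w + barycenter w'.
Proof. exact: big_cat. Qed.

Lemma mass_lift m w : mass (lift_weights m w) = mass w.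
Proof. by rewrite /mass big_map. Qed.

Lemma barycenter_lift m w : barycenter (lift_weights m w) =
  row_mx (barycenter w) (mass w * m%:~R)%:M.
Proof.
elim: w => [|p w IH].
  by rewrite !barycenter_nil mass_nil mul0r (raddf0 (@scalar_mx R 1)) row_mx0.
rewrite /= !barycenter_cons mass_cons /= IH lattice_point_at_level.
by rewrite scale_row_mx add_row_mx scale_scalar_mx -raddfD /= mulrDl.
Qed.

Lemma positive_lift m w : positive (lift_weights m w) = positive w.
Proof. by rewrite /positive all_map. Qed.

Lemma unzip1_lift m w : unzip1 (lift_weights m w) = map (at_level m) (unzip1 w).
Proof. by rewrite /unzip1 -!map_comp. Qed.

Lemma lift_exists m s (c : seq ('rV[int]_(n + 1) * R)) :
  unzip1 c = map (at_level m) s ->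
  exists2 w, unzip1 w = s & c = lift_weights m w.
Proof.
elim: c s => [|[v a] c IH] [|u s] //=; first by exists [::].
by case=> -> /IH[w <- ->]; exists ((u, a) :: w).
Qed.

(** Brings a representation into normal form: the level is the floor of the height of [x], the
    height then fixes the mass of the lower part, and projection adds the two weights over a shared
    vertex. Uniqueness is thus reduced to uniqueness in [K] and [wglued_inj]. *)
Lemma prism_represents K x c : represents (prism K) x c ->
  exists w1 w2 w, let m := Num.floor (x 0 (rshift n ord0)) in
    [/\ represents K (lsubmx x) w, wglued w1 w2 w, positive w1 /\ positive w2,
        mass w1 = (m + 1)%:~R - x 0 (rshift n ord0) &
        c = lift_weights m w1 ++ lift_weights (m + 1) w2].
Proof.
case=> [[m [s1 [s2 [s [Ks g Ec]]]]] pc mc bc].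
have [w1 Ew1 Ec1] : exists2 w1, unzip1 w1 = s1 &
    take (size s1) c = lift_weights m w1.
  by apply: lift_exists; rewrite /unzip1 map_take -/(unzip1 _) Ec -{1}(size_map (at_level m)) take_size_cat.
have [w2 Ew2 Ec2] : exists2 w2, unzip1 w2 = s2 &
    drop (size s1) c = lift_weights (m + 1) w2.
  by apply: lift_exists; rewrite /unzip1 map_drop -/(unzip1 _) Ec -{1}(size_map (at_level m)) drop_size_cat.
have {Ec Ec1 Ec2} Ec : c = lift_weights m w1 ++ lift_weights (m + 1) w2.
  by rewrite -Ec1 -Ec2 cat_take_drop.
move: g; rewrite -Ew1 -Ew2 => /wglued_exists[w g Ew].
move: pc; rewrite Ec /positive all_cat -!/(positive _) !positive_lift.
case/andP=> p1 p2.
move: mc; rewrite Ec mass_cat !mass_lift => mc.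
move: bc; rewrite Ec barycenter_cat !barycenter_lift add_row_mx -raddfD /=.
rewrite -(wglued_barycenter g) => bc.
have Ex : x 0 (rshift n ord0) = m%:~R + (1 - mass w1).
  have m2 : mass w2 = 1 - mass w1 by lra.
  by rewrite -bc row_mxEr !mxE eqxx mulr1n m2 intrD; ring.
have rw : represents K (lsubmx x) w.
  split; [by rewrite Ew | exact: (wglued_positive g) | |].
    by rewrite (wglued_mass g).
  by rewrite -bc row_mxKl.
have := mass_ge0 p2; have := mass_ge0 p1.
rewrite le0r => /orP[/eqP m1|m1] m2.
  (* With nothing at level [m], all of [c] lies at level [m + 1], which is the floor of the height;
     it is relabelled as the lower part there. *)
  have w10 := mass_eq0 p1 m1; subst w1.
  have fx : Num.floor (x 0 (rshift n ord0)) = m + 1.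
    by apply: floor_def; rewrite Ex mass_nil subr0 !intrD; lra.
  exists w2, [::], w; rewrite fx; split => //=.
  + by inversion g; subst; exact: wglued_nilr.
  + by rewrite Ex mass_nil intrD; move: mc; rewrite mass_nil => mc; lra.
  + by rewrite cats0.
have fx : Num.floor (x 0 (rshift n ord0)) = m.
  by apply: floor_def; rewrite Ex intrD; lra.
exists w1, w2, w; rewrite fx; split => //.
by rewrite Ex intrD; lra.
Qed.

Lemma prism_ordered_triangulation K :
  ordered_triangulation (R := R) K -> ordered_triangulation (R := R) (prism K).
Proof.
move=> hK; split.
- move=> c c' /subseqP[b sz ->] [m [s1 [s2 [s [Ks g Ec]]]]].
  set b1 := take (size s1) b; set b2 := drop (size s1) b.
  have sz1 : size b1 = size s1.
    by rewrite size_takel // sz Ec size_cat !size_map leq_addr.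
  have [||s' sub g'] := @glued_subseq _ _ _ _ (mask b1 s1) (mask b2 s2) g.
  + exact: mask_subseq.
  + exact: mask_subseq.
  exists m, (mask b1 s1), (mask b2 s2), s'; split => //.
    exact: (ot_sub hK sub Ks).
  by rewrite !map_mask -mask_cat ?size_map // cat_take_drop -Ec.
- move=> z c [m [s1 [s2 [s [Ks g Ec]]]]].
  pose l := z 0 (rshift n ord0).
  have Ez : z = at_level l (lsubmx z).
    rewrite -[LHS]hsubmxK; congr row_mx; apply/rowP => i.
    by rewrite !ord1 !mxE eqxx mulr1n.
  exists (l + m), [seq lsubmx z + v | v <- s1], [seq lsubmx z + v | v <- s2],
    [seq lsubmx z + v | v <- s]; split.
  + exact: (ot_translate hK).
  + exact: glued_map.
  + rewrite Ec map_cat -!map_comp; congr (_ ++ _); apply: eq_map => v /=.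
      by rewrite {1}Ez at_levelD.
    by rewrite {1}Ez at_levelD addrA.
- move=> z; exists (z 0 (rshift n ord0)), [:: lsubmx z], [::], [:: lsubmx z].
  split; [exact: (ot_single hK) | exact: glued_nilr|].
  congr [:: _]; rewrite -[LHS]hsubmxK; congr row_mx; apply/rowP => i.
  by rewrite !ord1 !mxE eqxx mulr1n.
- move=> c [m [s1 [s2 [s [Ks g ->]]]]].
  have [s' [Ks' sub sz]] := ot_pure hK Ks.
  have [|s1' [s2' [g' sub1 sub2 sz']]] := glued_extend g sub; first by rewrite sz.
  exists (map (at_level m) s1' ++ map (at_level (m + 1)) s2'); split.
  + by exists m, s1', s2', s'.
  + by apply: cat_subseq; apply: map_subseq.
  + by rewrite size_cat !size_map sz' sz addn1.
- move=> x; set t := x 0 (rshift n ord0); set m := Num.floor t.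
  have [w [Kw pw mw bw]] := ot_cover hK (lsubmx x).
  have /andP[t1 t2] := floor_itv t; rewrite -/m intrD in t1 t2.
  (* Mass [m + 1 - t] at level [m] and [t - m] at level [m + 1] give the height [t]. *)
  have [||w1 [w2 [g p1 p2 m1]]] := @wglued_cut _ _ w (m%:~R + 1 - t) => //.
    by rewrite mw; lra.
  have m2 : mass w2 = t - m%:~R by have := wglued_mass g; lra.
  exists (lift_weights m w1 ++ lift_weights (m + 1) w2); split.
  + exists m, (unzip1 w1), (unzip1 w2), (unzip1 w); split => //.
      exact: wglued_unzip1.
    by rewrite -!unzip1_lift -map_cat.
  + by rewrite /positive all_cat -!/(positive _) !positive_lift p1.
  + by rewrite mass_cat !mass_lift -(wglued_mass g).
  + rewrite barycenter_cat !barycenter_lift add_row_mx -raddfD /=.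
    rewrite -(wglued_barycenter g) bw m1 m2 -[RHS]hsubmxK; congr row_mx.
    apply/rowP => i; rewrite !ord1 !mxE eqxx mulr1n intrD -/t; ring.
- move=> x c c' /prism_represents[w1 [w2 [w [rw g [p1 p2] m1 ->]]]].
  case/prism_represents=> [w1' [w2' [w' [rw' g' [p1' p2'] m1' ->]]]].
  move: g'; rewrite -(ot_unique hK rw rw') => g'.
  have m11 : mass w1 = mass w1' by rewrite m1 m1'.
  by have [-> ->] := wglued_inj g g' p1 p2 p1' p2' m11.
Qed.

Lemma prism_cyclic_triangle K : cyclic_triangle K -> cyclic_triangle (prism K).
Proof.
case=> u [v [t [uv vt tu]]].
exists (at_level 0 u), (at_level 0 v), (at_level 0 t).
have edge a b : K [:: a; b] -> prism K [:: at_level 0 a; at_level 0 b].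
  by move=> ab; exists 0, [:: a; b], [::], [:: a; b]; split => //; exact: glued_nilr.
by split; apply: edge.
Qed.

End Prism.

(** * Simplices of an ordered triangulation *)

Lemma convex_comb (R : realType) (V : lmodType R) (A : set V) (x y : V) (t : R) :
  convex_set A -> A x -> A y -> 0 <= t <= 1 -> A (t *: x + (1 - t) *: y).
Proof.
move=> cA Ax Ay /andP[t0 t1]; have := cA x y (Itv01 t0 t1).
by rewrite !inE; apply.
Qed.

Lemma convex_setI (R : realType) (V : lmodType R) (A : set V) :
  (forall (x y : V) (t : R), A x -> A y -> 0 <= t <= 1 ->
    A (t *: x + (1 - t) *: y)) -> convex_set A.
Proof.
move=> cA x y t; rewrite !inE => Ax Ay; apply: cA => //.
by apply/andP; split; [exact: ge0 | exact: le1].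
Qed.

Lemma convex_hull_convex (R : realType) (V : lmodType R) (A : set V) :
  convex_set (convex_hull A).
Proof.
apply: convex_setI => x y t Hx Hy t01 B [cB AB].
by apply: convex_comb => //; [apply: Hx | apply: Hy].
Qed.

Section ScalarForm.
Context {R : realType} {n : nat}.

Definition dotf (c : 'cV[R]_n) (x : 'rV[R]_n) : R := (x *m c) 0 0.

Lemma dotf_is_linear c : linear_for *%R (dotf c).
Proof. by move=> a x y; rewrite /dotf mulmxDl -scalemxAl !mxE. Qed.

HB.instance Definition _ c :=
  GRing.isLinear.Build R 'rV[R]_n R *%R (dotf c) (dotf_is_linear c).

End ScalarForm.

(** * Convex hulls of finite lists of lattice points *)

Section Hull.
Context {R : realType} {n : nat}.
Implicit Types (S : seq 'rV[int]_n) (lam : 'rV[int]_n -> R) (x : 'rV[R]_n).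

Definition combination S lam : 'rV[R]_n :=
  \sum_(v <- S) lam v *: lattice_point v.

Definition weights S lam : Prop :=
  (forall v, 0 <= lam v) /\ \sum_(v <- S) lam v = 1.

Definition hull S : set 'rV[R]_n :=
  [set x | exists2 lam, weights S lam & x = combination S lam].

Definition positive_part S lam : seq ('rV[int]_n * R) :=
  [seq (v, lam v) | v <- S & 0 < lam v].

Lemma sum_pred1 (V : nmodType) (I : eqType) (r : seq I) (i : I) (F : I -> V) :
  i \in r -> uniq r -> \sum_(j <- r | j == i) F j = F i.
Proof.
move=> ir ur; rewrite big_mkcond /= (bigD1_seq i) //= eqxx big1 ?addr0 //.
by move=> j /negbTE->.
Qed.

Lemma linear_combination (l : {scalar 'rV[R]_n}) S lam :
  l (combination S lam) = \sum_(v <- S) lam v * l (lattice_point v).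
Proof. by rewrite linear_sum; apply: eq_bigr => v _; rewrite linearZ. Qed.

Lemma hull_vertex S v : uniq S -> v \in S -> hull S (lattice_point v).
Proof.
move=> uS vS; exists (fun u => (u == v)%:R).
  split=> [u|]; first by rewrite ler0n.
  rewrite -[RHS](sum_pred1 (fun=> 1) vS uS) [RHS]big_mkcond /=.
  by apply: eq_bigr => u _; case: eqP.
rewrite -[LHS](sum_pred1 (@lattice_point R n) vS uS) big_mkcond /=.
by apply: eq_bigr => u _; case: eqP => _; rewrite ?scale1r ?scale0r.
Qed.

Lemma hull_is_convex S : convex_set (hull S).
Proof.
apply: convex_setI => x y t [lam [l0 l1] ->] [mu [m0 m1] ->] /andP[t0 t1].
exists (fun v => t * lam v + (1 - t) * mu v).
  split=> [v|]; first by rewrite addr_ge0 // mulr_ge0 // subr_ge0.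
  by rewrite big_split /= -!mulr_sumr l1 m1 !mulr1 addrC subrK.
rewrite /combination !scaler_sumr -big_split; apply: eq_bigr => v _ /=.
by rewrite !scalerA -scalerDl.
Qed.

(** The weights are not normalized, so that the induction can drop a point of [S]. *)
Lemma combination_in_convex (C : set 'rV[R]_n) S lam : convex_set C ->
  (forall v, v \in S -> C (lattice_point v)) -> (forall v, 0 <= lam v) ->
  0 < \sum_(v <- S) lam v ->
  C ((\sum_(v <- S) lam v)^-1 *: combination S lam).
Proof.
move=> cC + l0; rewrite /combination.
elim: S => [|u S IH] CS; first by rewrite big_nil ltxx.
rewrite !big_cons => pos.
have Cu : C (lattice_point u) by apply: CS; rewrite mem_head.
have CS' v : v \in S -> C (lattice_point v).
  by move=> vS; apply: CS; rewrite inE vS orbT.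
have : 0 <= \sum_(v <- S) lam v by rewrite sumr_ge0.
rewrite le0r => /orP[s0|s0].
  have z : \sum_(v <- S) lam v *: lattice_point v = 0 :> 'rV[R]_n.
    rewrite big_seq big1 // => v vS; move: s0; rewrite psumr_eq0 //.
    by move=> /allP/(_ v vS)/= /eqP->; rewrite scale0r.
  rewrite z addr0 (eqP s0) addr0 scalerA mulVf ?scale1r //.
  by move: pos; rewrite (eqP s0) addr0 => /gt_eqF->.
set s := \sum_(v <- S) lam v in s0 pos *.
have cn0 : lam u + s != 0 by rewrite gt_eqF.
have := @convex_comb _ _ C _ _ (lam u / (lam u + s)) cC Cu (IH CS' s0).
have -> : 1 - lam u / (lam u + s) = s / (lam u + s) by field.
rewrite scalerDr !scalerA [_ / _ * s^-1]mulrAC mulfV ?gt_eqF // mul1r.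
rewrite [lam u / _]mulrC; apply.
by rewrite ler_pdivrMl // mulr1 lerDl (ltW s0) andbT mulr_ge0 // invr_ge0 ltW.
Qed.

Lemma hullE S : uniq S ->
  hull S = convex_hull [set lattice_point v | v in [set` S]].
Proof.
move=> uS; apply/seteqP; split=> [x [lam [l0 l1] ->] C [cC AC]|].
  have CS v : v \in S -> C (lattice_point v) by move=> vS; apply: AC; exists v.
  have := combination_in_convex cC CS l0; rewrite l1 invr1 scale1r; apply.
  exact: ltr01.
apply: smallest_sub; first exact: hull_is_convex.
by move=> _ [v /= vS <-]; exact: hull_vertex.
Qed.

Lemma lattice_pointD z z' :
  lattice_point (z + z') = lattice_point z + lattice_point z' :> 'rV[R]_n.
Proof. by rewrite /lattice_point map_mxD. Qed.

Lemma hull_translate z S :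
  hull [seq z + v | v <- S] = translate (lattice_point z) (hull S).
Proof.
apply/seteqP; split=> x.
  case=> lam [l0 l1] ->; rewrite big_map in l1.
  exists (combination S (fun v => lam (z + v))); first by exists (fun v => lam (z + v)).
  rewrite /combination big_map -[in LHS](scale1r (lattice_point z)) -l1.
  rewrite scaler_suml -big_split; apply: eq_bigr => v _ /=.
  by rewrite lattice_pointD scalerDr.
case=> y [lam [l0 l1] ->] <-; exists (fun v => lam (v - z)).
  split=> //; rewrite big_map -[RHS]l1; apply: eq_bigr => v _.
  by rewrite addrAC subrr add0r.
rewrite /combination big_map -[in LHS](scale1r (lattice_point z)) -l1.
rewrite scaler_suml -big_split; apply: eq_bigr => v _ /=.
by rewrite lattice_pointD scalerDr addrAC subrr add0r.
Qed.

Lemma positive_part_represents K S lam :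
  ordered_triangulation (R := R) K -> K S -> weights S lam ->
  represents K (combination S lam) (positive_part S lam).
Proof.
move=> hK KS [l0 l1].
have drop (V : nmodType) (F : 'rV[int]_n -> V) :
    (forall v, lam v = 0 -> F v = 0) ->
    \sum_(v <- S | 0 < lam v) F v = \sum_(v <- S) F v.
  move=> F0; rewrite [LHS]big_mkcond; apply: eq_bigr => v _ /=.
  by case: ltP => // lv; rewrite F0 //; apply/eqP; rewrite eq_le lv l0.
split.
- rewrite /positive_part /unzip1 -map_comp map_id_in //.
  exact: (ot_sub hK (filter_subseq _ _)).
- by rewrite /positive /positive_part all_map; apply/allP => v; rewrite mem_filter => /andP[].
- by rewrite /mass /positive_part big_map big_filter drop.
- rewrite /barycenter /positive_part big_map big_filter drop // => v ->.
  by rewrite scale0r.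
Qed.

Lemma mem_positive_part S lam v :
  v \in S -> 0 < lam v -> (v, lam v) \in positive_part S lam.
Proof. by move=> vS lv; apply/mapP; exists v; rewrite ?mem_filter ?lv. Qed.

Lemma positive_part_mem S lam v a :
  (v, a) \in positive_part S lam -> [/\ v \in S, a = lam v & 0 < a].
Proof. by case/mapP => u; rewrite mem_filter => /andP[lu uS] [-> ->]. Qed.

Lemma represents_hull K x w S : uniq S -> represents K x w ->
  {subset unzip1 w <= S} -> hull S x.
Proof.
move=> uS [_ pw mw bw] sub; exists (fun v => \sum_(p <- w | p.1 == v) p.2).
  split=> [v|].
    rewrite big_seq_cond sumr_ge0 // => p /andP[/(allP pw)/ltW //].
  rewrite -mw /mass (exchange_big_dep predT) //= [LHS]big_seq [RHS]big_seq.
  apply: eq_bigr => p pw'.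
  rewrite (eq_bigl (fun v => v == p.1)) => [|v]; last by rewrite eq_sym.
  rewrite (sum_pred1 (fun=> p.2)) //; apply: sub; exact: map_f.
rewrite -bw /barycenter /combination.
under [RHS]eq_bigr do rewrite scaler_suml.
rewrite (exchange_big_dep predT) //= [LHS]big_seq [RHS]big_seq.
apply: eq_bigr => p pw'.
rewrite (eq_bigl (fun v => v == p.1)) => [|v]; last by rewrite eq_sym.
rewrite (sum_pred1 (fun v => p.2 *: lattice_point v)) //; apply: sub; exact: map_f.
Qed.

End Hull.

(** * Affine independence of the vertices of a simplex *)

Section Triangulation.
Context {R : realType} {n : nat} {K : seq 'rV[int]_n -> Prop}.
Hypothesis hK : ordered_triangulation (R := R) K.
Implicit Types (S : seq 'rV[int]_n).

Lemma hull_unique S S' (lam mu : 'rV[int]_n -> R) : K S -> K S' ->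
  weights S lam -> weights S' mu -> combination S lam = combination S' mu ->
  positive_part S lam = positive_part S' mu.
Proof.
move=> KS KS' wl wm E; apply: (ot_unique hK (x := combination S lam)).
- exact: positive_part_represents hK KS wl.
- by rewrite E; exact: positive_part_represents hK KS' wm.
Qed.

(** The unit mass of a repeated vertex could be divided between its two copies in different ways,
    against [ot_unique]. *)
Lemma simplex_uniq S : K S -> uniq S.
Proof.
move=> KS.
have h2 : 0 < (1 / 2 : R) < 1 by lra.
have h3 : 0 < (1 / 3 : R) < 1 by lra.
apply/negPn/negP => /uniqPn-/(_ 0)[i [j [ij jS e]]].
set v := nth 0 S i in e.
have sub : subseq [:: v; v] S.
  rewrite -(cat_take_drop j S) -[[:: v; v]]/([:: v] ++ [:: v]).
  apply: cat_subseq; rewrite sub1seq.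
    apply/(nthP 0); exists i; last by rewrite nth_take.
    by rewrite size_take jS.
  apply/(nthP 0); exists 0%N; last by rewrite nth_drop addn0.
  by rewrite size_drop subn_gt0.
clear e; have rep (a : R) : 0 < a < 1 ->
    represents K (lattice_point v) [:: (v, a); (v, 1 - a)].
  move=> /andP[a0 a1]; split.
  - exact: (ot_sub hK sub).
  - by rewrite /positive /= a0 subr_gt0 a1.
  - by rewrite !mass_cons mass_nil /=; ring.
  - by rewrite !barycenter_cons barycenter_nil /= addr0 -scalerDl addrC subrK scale1r.
have := ot_unique hK (rep _ h2) (rep _ h3).
by move=> /(congr1 (fun s => (head (v, 0) s).2)) /=; lra.
Qed.

Lemma lattice_in_hull S v : K S -> hull S (lattice_point v : 'rV[R]_n) -> v \in S.
Proof.
move=> KS [lam wl E].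
have r1 : represents K (lattice_point v) [:: (v, 1 : R)].
  split; [exact: (ot_single hK) | by rewrite /positive /= ltr01 | |].
    by rewrite mass_cons mass_nil addr0.
  by rewrite barycenter_cons barycenter_nil addr0 scale1r.
have r2 := positive_part_represents hK KS wl; rewrite -E in r2.
have /positive_part_mem[] // : (v, 1) \in positive_part S lam.
by rewrite -(ot_unique hK r1 r2) mem_head.
Qed.

(** Perturbing the equal weights of the centroid by a small multiple of an affine dependence would
    represent the centroid a second time. The bound [M] exceeds every [|c u|], which keeps the
    perturbed weights positive. *)
Lemma simplex_affine_free S (c : 'rV[int]_n -> R) : K S ->
  \sum_(v <- S) c v = 0 -> \sum_(v <- S) c v *: lattice_point v = 0 :> 'rV[R]_n ->
  forall v, v \in S -> c v = 0.
Proof.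
move=> KS c0 cv0 v vS.
have S0 : 0 < (size S)%:R :> R by rewrite ltr0n; case: (S) vS.
set N := (size S)%:R in S0 *.
pose M := 1 + \sum_(u <- S) `|c u|.
have M0 : 0 < M by rewrite ltr_pwDl // sumr_ge0.
have cM u : u \in S -> `|c u| < M.
  move=> uS; rewrite /M (big_rem u) //= addrCA ltrDl ltr_pwDl //.
  exact: sumr_ge0.
pose lam (u : 'rV[int]_n) := N^-1.
pose mu u := if u \in S then N^-1 * (1 + c u / M) else 0.
have muE u : u \in S -> mu u = N^-1 + N^-1 / M * c u.
  by rewrite /mu => ->; rewrite mulrDr mulr1 [c u / M]mulrC mulrA.
have mu0 u : u \in S -> 0 < mu u.
  rewrite /mu => uS; rewrite uS mulr_gt0 ?invr_gt0 // -[X in X < _](subrr 1) ltrD2l.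
  rewrite ltrNl -mulNr ltr_pdivrMr // mul1r.
  by apply: le_lt_trans (cM u uS); rewrite ler_normr lexx orbT.
have sN : \sum_(u <- S) N^-1 = 1 :> R.
  by rewrite big_const_seq count_predT iter_addr_0 -[_ *+ _]mulr_natr mulVf ?gt_eqF.
have wl : weights S lam.
  by split=> [u|//]; rewrite /lam invr_ge0 ltW.
have wm : weights S mu.
  split=> [u|]; first by rewrite /mu; case: ifP => [uS|//]; move: (mu0 u uS); rewrite /mu uS => /ltW.
  rewrite big_seq (eq_bigr _ muE) -big_seq big_split /= sN -mulr_sumr c0 mulr0.
  by rewrite addr0.
have E : combination S lam = combination S mu.
  rewrite /combination [RHS]big_seq.
  under [RHS]eq_bigr => u uS do rewrite muE // scalerDl -scalerA.
  by rewrite -big_seq big_split /= -!scaler_sumr cv0 scaler0 addr0.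
have := hull_unique KS KS wl wm E.
move=> /(congr1 (fun s => (v, lam v) \in s)).
rewrite mem_positive_part // ?invr_gt0 // => /esym/positive_part_mem[_ e _].
move: e; rewrite muE // /lam => /eqP; rewrite addrC -subr_eq subrr eq_sym.
by rewrite !mulf_eq0 !invr_eq0 (gt_eqF S0) (gt_eqF M0) => /eqP.
Qed.

(** By affine independence the matrix with rows [(v, 1)] has independent rows, hence a right
    inverse. *)
Lemma simplex_affine_interpolation S (g : 'rV[int]_n -> R) : K S ->
  exists (l : {scalar 'rV[R]_n}) (b : R),
    forall v, v \in S -> l (lattice_point v) = b + g v.
Proof.
move=> KS.
pose M : 'M[R]_(size S, n + 1) :=
  \matrix_i row_mx (lattice_point (nth 0 S i)) 1%:M.
have Mfree : row_free M.
  rewrite -kermx_eq0; apply/eqP/row_matrixP => i; rewrite row0.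
  have : row i (kermx M) *m M = 0 by apply/sub_kermxP; exact: row_sub.
  move: (row i _) => r rM; pose c v := r 0 (insubd i (index v S)).
  have cE (j : 'I_(size S)) : c (nth 0 S j) = r 0 j.
    congr (r 0 _); apply/val_inj; rewrite /= insubdK ?index_uniq ?simplex_uniq //.
    by rewrite -topredE /=.
  have sE (V : nmodType) (F : 'rV[int]_n -> V) :
      \sum_(v <- S) F v = \sum_(j < size S) F (nth 0 S j).
    by rewrite (big_nth 0) big_mkord.
  have c0 : forall v, v \in S -> c v = 0.
    apply: simplex_affine_free => //.
    - rewrite sE; move: rM => /matrixP/(_ 0 (rshift n 0)); rewrite mxE [RHS]mxE => E; rewrite -[RHS]E.
      by apply: eq_bigr => j _; rewrite cE mxE row_mxEr mxE mulr1.
    - rewrite sE; apply/rowP => k; rewrite summxE [RHS]mxE.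
      move: rM => /matrixP/(_ 0 (lshift 1 k)); rewrite mxE [RHS]mxE => E; rewrite -[RHS]E.
      by apply: eq_bigr => j _; rewrite cE [M _ _]mxE row_mxEl !mxE.
  by apply/rowP => j; rewrite -cE c0 ?mem_nth // mxE.
pose X := pinvmx M *m \col_i g (nth 0 S i).
exists (dotf (usubmx X)), (- dsubmx X 0 0) => v vS.
have : M *m X = \col_i g (nth 0 S i) by rewrite mulmxA mulmxVp // mul1mx.
move: (vS) => /(nthP 0)[i iS <-] /matrixP/(_ (Ordinal iS) 0).
rewrite [RHS]mxE /= => <-; rewrite /dotf.
have -> (A : 'cV[R]_(n + 1)) : (M *m A) (Ordinal iS) 0 =
    (row_mx (lattice_point (nth 0 S i)) 1%:M *m A) 0 0.
  have <- : row (Ordinal iS) M = row_mx (lattice_point (nth 0 S i)) 1%:M.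
    by rewrite rowK.
  by rewrite -row_mul [RHS]mxE.
by rewrite -{3}[X]vsubmxK mul_row_col mul1mx [X in _ + X]mxE; ring.
Qed.

End Triangulation.

(** * From ordered triangulations to periodic ones *)

Section PeriodicTriangulation.
Context {R : realType} {n : nat} {K : seq 'rV[int]_n -> Prop}.
Hypothesis hK : ordered_triangulation (R := R) K.
Implicit Types (S : seq 'rV[int]_n) (x : 'rV[R]_n).

Definition hull_complex (K' : seq 'rV[int]_n -> Prop) : set (set 'rV[R]_n) :=
  [set hull S | S in [set S | K' S /\ size S = n.+1]].

Lemma hull_represents S x : K S ->
  hull S x <-> exists2 w, represents K x w & {subset unzip1 w <= S}.
Proof.
move=> KS; split=> [[lam wl ->]|[w rw sub]].
  exists (positive_part S lam); first exact: positive_part_represents.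
  move=> v /mapP[[u a] /positive_part_mem[uS _ _] /= ->] //.
by apply: (represents_hull _ rw sub); exact: (simplex_uniq hK KS).
Qed.

(** Up to a constant, [l] interpolates 0 at the vertices in [A] and -1 at the others, so that
    [b - l x] is the total weight of [x] outside [A]. *)
Lemma simplex_face_form S (A : pred 'rV[int]_n) : K S ->
  exists (l : {scalar 'rV[R]_n}) (b : R),
    (forall x, hull S x -> l x <= b) /\
    (forall x w, hull S x -> represents K x w ->
      l x = b <-> {subset unzip1 w <= A}).
Proof.
move=> KS.
have [l [b lb]] := simplex_affine_interpolation hK (fun v => - (~~ A v)%:R) KS.
have lE lam : weights S lam ->
    l (combination S lam) = b - \sum_(v <- S | ~~ A v) lam v.
  move=> [l0 l1]; rewrite linear_combination big_seq.
  under eq_bigr => v vS do rewrite lb // mulrDr.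
  rewrite -big_seq big_split /= -mulr_suml l1 mul1r; congr (_ + _).
  rewrite -sumrN [RHS]big_mkcond; apply: eq_bigr => v _ /=.
  by case: (A v); rewrite /= ?mulr0n ?oppr0 ?mulr0 // mulrN mulr1.
exists l, b; split=> [_ [lam wl ->]|_ w [lam wl ->] rw].
  by rewrite lE // lerBlDr lerDl sumr_ge0 // => v _; case: wl.
have pp := positive_part_represents hK KS wl.
rewrite (ot_unique hK rw pp) lE //; split.
  move=> /eqP; rewrite -subr_eq0 addrC addKr oppr_eq0 psumr_eq0; last first.
    by move=> v _; case: wl.
  move=> /allP lam0 v /mapP[[u a] /positive_part_mem[uS -> au] /= ->].
  by move: (lam0 u uS) => /=; rewrite (gt_eqF au) implybF negbK.
move=> sub; rewrite big_seq_cond big1 ?subr0 // => v /andP[vS Av].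
apply/eqP; rewrite eq_le; case: (wl) => -> _; rewrite andbT leNgt.
apply: contra Av => lv; apply: sub; apply/mapP; exists (v, lam v) => //.
exact: mem_positive_part.
Qed.

Lemma hull_full S : K S -> size S = n.+1 -> is_simplex (hull S : set 'rV[R]_n).
Proof.
move=> KS sz; have uS := simplex_uniq hK KS.
exists (fun i : 'I_n.+1 => lattice_point (nth 0 S i)).
  move=> c c0 cp i.
  pose d v := c (inord (index v S)).
  have dE (j : 'I_n.+1) : d (nth 0 S j) = c j.
    by rewrite /d index_uniq ?sz // inord_val.
  rewrite -dE; apply: (simplex_affine_free hK KS); last by rewrite mem_nth // sz.
    by rewrite (big_nth 0) big_mkord sz; apply: etrans c0; apply: eq_bigr => j _; rewrite dE.
  rewrite (big_nth 0) big_mkord sz; apply: etrans cp.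
  by apply: eq_bigr => j _; rewrite dE.
rewrite hullE //; congr convex_hull; apply/seteqP; split=> x.
  move=> [v /= /(nthP 0)[i iS <-] <-].
  by rewrite sz in iS; exists (Ordinal iS).
by move=> [i _ <-]; exists (nth 0 S i) => //=; rewrite mem_nth // sz.
Qed.

Lemma hull_vertices S :
  K S -> vertices (hull S : set 'rV[R]_n) = [set lattice_point v | v in [set` S]].
Proof.
move=> KS; apply/seteqP; split=> x.
  move=> [l [b [lb E]]].
  have [] : (hull S `&` [set y | l y = b]) x by rewrite -E.
  case=> lam wl Ex lx.
  (* A maximum of [l] at [x] is also attained at every vertex of positive weight, so such a vertex
     must be [x] itself. *)
  have [u uS lu] : exists2 u, u \in S & 0 < lam u.
    case: (boolP (has (fun v => 0 < lam v) S)) => [/hasP[u uS lu]|]; first by exists u.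
    rewrite -all_predC => /allP no; case: wl => l0 /eqP.
    rewrite big_seq big1 ?(eq_sym 0) ?oner_eq0 // => v /no/=.
    by rewrite -leNgt => lv; apply/eqP; rewrite eq_le lv l0.
  have hu : hull S (lattice_point u : 'rV[R]_n).
    by apply: hull_vertex => //; exact: (simplex_uniq hK KS).
  suff lub : l (lattice_point u) = b.
    by exists u => //; have : [set x] (lattice_point u : 'rV[R]_n) by rewrite E.
  (* The guard makes the summand nonnegative for every [v], as [psumr_eq0] demands. *)
  have s0 : \sum_(v <- S) (if v \in S then lam v * (b - l (lattice_point v)) else 0) = 0.
    rewrite big_seq (eq_bigr (fun v => lam v * (b - l (lattice_point v)))); last first.
      by move=> v ->.
    rewrite -big_seq; under eq_bigr do rewrite mulrBr.
    rewrite big_split /= sumrN -mulr_suml -linear_combination -Ex lx.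
    by case: wl => _ ->; rewrite mul1r subrr.
  move/eqP: s0; rewrite psumr_eq0; last first.
    move=> v _; case: ifP => // vS; rewrite mulr_ge0 //; first by case: wl.
    by rewrite subr_ge0 lb //; apply: hull_vertex => //; exact: (simplex_uniq hK KS).
  move=> /allP/(_ u uS)/=; rewrite uS mulf_eq0 (gt_eqF lu) /= subr_eq0.
  by move=> /eqP.
move=> [v /= vS <-].
have [l [b [lb lE]]] := simplex_face_form (pred1 v) KS.
exists l, b; split=> //.
have hv : hull S (lattice_point v : 'rV[R]_n).
  by apply: hull_vertex => //; exact: (simplex_uniq hK KS).
apply/seteqP; split=> [_ ->|y [hy ly]].
  split=> //=; have [w rw _] := (hull_represents _ KS).1 hv.
  apply/(lE _ w hv rw).
  have rv : represents K (lattice_point v) [:: (v, 1 : R)].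
    split; [exact: (ot_single hK) | by rewrite /positive /= ltr01 | |].
      by rewrite mass_cons mass_nil addr0.
    by rewrite barycenter_cons barycenter_nil addr0 scale1r.
  by rewrite (ot_unique hK rw rv) => u; rewrite !inE.
have [w rw _] := (hull_represents _ KS).1 hy.
have sub := (lE _ w hy rw).1 ly.
case: rw => _ _ mw bw; rewrite /= -bw /barycenter.
rewrite big_seq (eq_bigr (fun p => p.2 *: lattice_point v)); last first.
  by move=> p pw; have /eqP-> := sub p.1 (map_f _ pw).
by rewrite -big_seq -scaler_suml -/(mass w) mw scale1r.
Qed.

Theorem hull_complex_periodic : periodic_triangulation (hull_complex K).
Proof.
split.
- by move=> _ [S [KS sz] <-]; exact: hull_full.
- apply/seteqP; split=> x.
    by move=> [_ [S [KS _] <-]]; rewrite hull_vertices // => -[v _ <-]; exists v.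
  move=> [z _ <-]; have [S [KS sub sz]] := ot_pure hK (ot_single hK z).
  exists (hull S); first by exists S.
  by rewrite hull_vertices //; exists z => //=; rewrite -sub1seq.
- apply/seteqP; split=> // x _; have [w rw] := ot_cover hK x.
  have [Kw _ _ _] := rw; have [S [KS sub sz]] := ot_pure hK Kw.
  exists (hull S); first by exists S.
  by apply/hull_represents => //; exists w => //; exact: mem_subseq.
- suff F S S' : K S -> K S' ->
      face (hull S : set 'rV[R]_n) (hull S `&` hull S').
    by move=> _ _ [S [KS _] <-] [S' [KS' _] <-]; split; [|rewrite setIC]; exact: F.
  (* By uniqueness of representations, a point of [hull S] lies in [hull S'] exactly if its weights
     are carried by vertices of [S']. *)
  move=> KS KS'; have [l [b [lb lE]]] := simplex_face_form (mem S') KS.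
  exists l, b; split=> //; apply/seteqP; split=> x [hx].
    move=> /(hull_represents _ KS')[w rw sub]; split=> //=.
    exact/(lE _ w hx rw).
  have [w rw _] := (hull_represents _ KS).1 hx.
  move=> /(lE _ w hx rw) sub; split=> //.
  by apply/hull_represents => //; exists w.
- move=> z; apply/seteqP; split=> s.
    move=> [_ [S [KS sz] <-] <-]; exists [seq z + v | v <- S].
      by split; [exact: (ot_translate hK) | rewrite size_map].
    exact: hull_translate.
  move=> [S [KS sz] <-]; exists (hull [seq - z + v | v <- S]).
    exists [seq - z + v | v <- S] => //.
    by split; [exact: (ot_translate hK) | rewrite size_map].
  rewrite -hull_translate -map_comp map_id_in // => v _ /=.
  by rewrite addrA subrr add0r.
Qed.

End PeriodicTriangulation.

(** * Non-regularity of prisms *)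

Section LatticeForms.
Context {R : realType} {n : nat}.
Implicit Types (L : 'cV[R]_n) (x : 'rV[R]_n) (z : 'rV[int]_n).

Lemma lattice_point_inj : injective (@lattice_point R n).
Proof.
move=> z z' /matrixP E; apply/matrixP => i j; apply/eqP.
by have := E i j; rewrite !mxE => /eqP; rewrite eqr_int.
Qed.

Lemma dotf_scalar (l : {scalar 'rV[R]_n}) x :
  l x = dotf (\col_i l (delta_mx 0 i)) x.
Proof.
rewrite {1}(row_sum_delta x) linear_sum /dotf mxE; apply: eq_bigr => i _.
by rewrite linearZ !mxE.
Qed.

Lemma dotf_comb a b L L' x :
  dotf (a *: L + b *: L') x = a * dotf L x + b * dotf L' x.
Proof. by rewrite /dotf mulmxDr -!scalemxAr !mxE. Qed.

(** A positive value at [z] would exceed [b] along the multiples of [z], and a negative one along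
    those of [- z]. *)
Lemma lattice_bounded_form L b :
  (forall z, dotf L (lattice_point z) <= b) -> forall x, dotf L x = 0.
Proof.
move=> bnd.
have le0 z : dotf L (lattice_point z) <= 0.
  rewrite leNgt; apply/negP => pos.
  have natE k : dotf L (lattice_point (z *+ k)) = dotf L (lattice_point z) *+ k.
    elim: k => [|k IH]; last by rewrite !mulrS lattice_pointD linearD /= IH.
    by rewrite !mulr0n /lattice_point map_mx0 linear0.
  have q0 : 0 <= `|b| / dotf L (lattice_point z) by rewrite divr_ge0 // ltW.
  have := archi_boundP q0; rewrite ltr_pdivrMr // => big.
  have := bnd (z *+ Num.bound (`|b| / dotf L (lattice_point z))).
  rewrite natE -mulr_natl leNgt => /negP; apply.
  exact: le_lt_trans (ler_norm b) big.
have eq0 z : dotf L (lattice_point z) = 0.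
  apply/eqP; rewrite eq_le le0 -oppr_le0 -linearN.
  by rewrite -[- lattice_point z]map_mxN; exact: le0.
move=> x; rewrite (row_sum_delta x) linear_sum big1 // => i _.
rewrite linearZ /= -[delta_mx 0 i]/(_) -(map_delta_mx (intmul 1)).
by rewrite eq0 mulr0.
Qed.

End LatticeForms.

Lemma dotf_row_mx (R : realType) n (L : 'cV[R]_(n + 1)) (x : 'rV[R]_n) (h : 'M_1) :
  dotf L (row_mx x h) = dotf (usubmx L) x + h 0 0 * dsubmx L 0 0.
Proof. by rewrite /dotf -{1}[L]vsubmxK mul_row_col mxE [X in _ + X]mxE big_ord1. Qed.

(** Translation changes the sum of the points of [S] by [size S] times [z]. *)
Lemma translate_not_self n (z : 'rV[int]_n) (S : seq 'rV[int]_n) :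
  uniq S -> (0 < size S)%N -> [seq z + v | v <- S] =i S -> z = 0.
Proof.
move=> uS S0 E.
have pe : perm_eq [seq z + v | v <- S] S.
  by apply: uniq_perm => //; rewrite map_inj_uniq //; exact: addrI.
have : \sum_(v <- [seq z + v | v <- S]) v = \sum_(v <- S) v by exact: perm_big.
rewrite big_map big_split /= => /eqP.
rewrite -[X in _ == X]add0r (inj_eq (addIr _)) big_const_seq count_predT iter_addr_0 => /eqP/rowP zS.
apply/rowP => i; have := zS i; rewrite -[z *+ _]scaler_nat !mxE => /eqP.
by rewrite mulf_eq0 pnatr_eq0 -[_ == _]negbK -lt0n S0 => /eqP.
Qed.

Lemma mul_sign_trans (R : realDomainType) (a b c : R) :
  0 < a * b -> b * c < 0 -> a * c < 0.
Proof.
move=> ab bc; have b0 : b != 0 by apply: contraTneq ab => ->; rewrite mulr0 ltxx.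
have : a * c * (b * b) < 0 by rewrite mulrACA [c * b]mulrC pmulr_rlt0.
by rewrite pmulr_llt0 // lt0r mulf_neq0 //= -expr2 sqr_ge0.
Qed.

(** * Supporting hyperplanes of the lifted lattice *)

Section Supports.
Context {R : realType} {n : nat} {K : seq 'rV[int]_n -> Prop}.
Hypothesis hK : ordered_triangulation (R := R) K.
Variable f : 'rV[int]_n -> R.
Implicit Types (S : seq 'rV[int]_n) (L : 'cV[R]_n).

Definition supports S L (c b : R) : Prop :=
  c != 0 /\ forall z, dotf L (lattice_point z) + f z * c <= b ?= iff (z \in S).

Lemma facet_supports S F : K S -> (0 < size S)%N ->
  facets (lifted_hull f) F -> vertical_proj @` F = hull S ->
  exists L c b, supports S L c b.
Proof.
move=> KS S0 [[l [b [lb FE]]] [k [[_ rF] [[p pfree pC] _]]]] projF.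
set C := lifted_hull f in lb FE pC.
pose L := \col_i l (delta_mx 0 i); set c := dsubmx L 0 0.
have lE x : l x = dotf (usubmx L) (vertical_proj x) + rsubmx x 0 0 * c.
  by rewrite dotf_scalar -/L -{1}[x]hsubmxK dotf_row_mx.
have llift z : l (lifted_point f z) = dotf (usubmx L) (lattice_point z) + f z * c.
  by rewrite lE /vertical_proj row_mxKl row_mxKr !mxE eqxx mulr1n.
have Clift z : C (lifted_point f z) by move=> B [_]; apply; exists z.
have hS z : z \in S -> exists2 x, F x & vertical_proj x = lattice_point z.
  move=> zS; have : hull S (lattice_point z : 'rV[R]_n).
    by apply: hull_vertex => //; exact: (simplex_uniq hK KS).
  by rewrite -projF => -[x Fx <-]; exists x.
have uS := simplex_uniq hK KS.
exists (usubmx L), c, b; split.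
  (* A vertical hyperplane would give a form bounded above on the lattice, hence zero; then the
     facet would be all of [C], against its smaller rank. *)
  apply/eqP => c0; have l0 x : l x = 0.
    rewrite lE c0 mulr0 addr0; apply: (lattice_bounded_form (b := b)) => z.
    by have := lb _ (Clift z); rewrite llift c0 mulr0 addr0.
  have [x Fx _] := hS (nth 0 S 0) (mem_nth 0 S0).
  have b0 : b = 0 by move: Fx; rewrite FE => -[_ /= <-].
  apply: (rF p) => // i; rewrite FE; split; first exact: pC.
  by rewrite /= l0 b0.
move=> z; rewrite -llift; split; first exact: lb (Clift z).
apply/idP/idP => [/eqP lz|zS].
  apply: (lattice_in_hull hK KS); rewrite -projF; exists (lifted_point f z).
    by rewrite FE.
  by rewrite /vertical_proj row_mxKl.
apply/negPn/negP => lz.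
(* [D] removes from [C] the points of the facet over [z]. It is convex because [z] is a vertex of
   [hull S], and it contains all lifted points if that of [z] is off the hyperplane; so it is all of
   [C], although the facet does have a point over [z]. *)
pose D : set 'rV[R]_(n + 1) :=
  [set x | C x /\ (l x = b -> vertical_proj x <> lattice_point z)].
have CD : C `<=` D.
  apply: smallest_sub; last first.
    move=> _ [v _ <-]; split=> // lv; rewrite /vertical_proj row_mxKl => E.
    by move: lz; rewrite -(lattice_point_inj E) lv eqxx.
  apply: convex_setI => x y t [Cx Dx] [Cy Dy] t01; split.
    by apply: convex_comb => //; exact: convex_hull_convex.
  have [->|t0] := eqVneq t 0; first by rewrite scale0r add0r subr0 scale1r.
  have [->|t1] := eqVneq t 1; first by rewrite subrr scale0r addr0 scale1r.
  rewrite linearD !linearZ /= => lxy Exy.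
  have lx := lb _ Cx; have ly := lb _ Cy.
  have tp : 0 < t by rewrite lt0r t0; case/andP: t01.
  have tq : 0 < 1 - t by rewrite subr_gt0 lt_neqAle t1; case/andP: t01.
  have ex (u v r : R) : u <= r -> v <= r -> t * u + (1 - t) * v = r -> u = r.
    by move=> ur vr uv; nra.
  have lxb : l x = b by exact: ex lx ly lxy.
  have lyb : l y = b by rewrite lxb in lxy; nra.
  have : vertices (hull S : set 'rV[R]_n) (lattice_point z).
    by rewrite (hull_vertices hK KS); exists z.
  move=> [l' [b' [lb' E']]].
  have hx : hull S (vertical_proj x) by rewrite -projF; exists x => //; rewrite FE.
  have hy : hull S (vertical_proj y) by rewrite -projF; exists y => //; rewrite FE.
  have l'z : l' (lattice_point z) = b'.
    by have [] : (hull S `&` [set x | l' x = b']) (lattice_point z) by rewrite -E'.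
  apply: (Dx lxb); suff : [set lattice_point z] (vertical_proj x) by [].
  rewrite E'; split => //=; apply: ex (lb' _ hx) (lb' _ hy) _.
  rewrite -[RHS]l'z -Exy /vertical_proj linearD !linearZ /=.
  by rewrite linearD !linearZ.
have [x Fx Ex] := hS z zS; move: Fx; rewrite FE => -[/CD[_ Dx] /= lx].
exact: Dx lx Ex.
Qed.


(* A supporting lower and a supporting upper hyperplane are parallel, because f
   is squeezed between them; so there is only one pair of them. *)
Lemma supports_opposite S1 L1 c1 b1 S1' L1' c1' b1' S2 L2 c2 b2 :
  (0 < size S1)%N -> (0 < size S1')%N ->
  supports S1 L1 c1 b1 -> supports S1' L1' c1' b1' -> supports S2 L2 c2 b2 ->
  c1 * c2 < 0 -> c1' * c2 < 0 -> S1 =i S1'.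
Proof.
move=> S1n S1'n [c1n H1] [c1'n H1'] [c2n H2] neg neg'.
(* [g] is [f] measured from the direction of the second hyperplane. In the combination with
   coefficients [|c2|] and [|c|] the values of [f] cancel, which leaves a bounded linear form, hence
   zero. *)
pose g z := f z + dotf L2 (lattice_point z) / c2.
have par S L c b : supports S L c b -> c * c2 < 0 ->
    forall z, dotf L (lattice_point z) + f z * c = c * g z.
  move=> [cn H] cc z.
  have opp : `|c2| * c + `|c| * c2 = 0.
    by case: (ltrgt0P c) cc cn; case: (ltrgt0P c2) => //; nra.
  have := @lattice_bounded_form _ _ (`|c2| *: L + `|c| *: L2) (`|c2| * b + `|c| * b2) _ (lattice_point z).
  rewrite dotf_comb => Hz.
  have {Hz} : `|c2| * dotf L (lattice_point z) + `|c| * dotf L2 (lattice_point z) = 0.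
    apply: Hz => v; rewrite dotf_comb.
    have := ler_wpM2l (normr_ge0 c2) (H v).1; have := ler_wpM2l (normr_ge0 c) (H2 v).1.
    have : f v * (`|c2| * c + `|c| * c2) = 0 by rewrite opp mulr0.
    by lra.
  set A := dotf L _; set B := dotf L2 _ => e.
  rewrite mulrDr mulrC addrC; congr (_ + _).
  apply: (mulfI (_ : `|c2| != 0)); first by rewrite normr_eq0.
  apply: (mulIf c2n).
  have -> : `|c2| * (c * (B / c2)) * c2 = `|c2| * c * B by field.
  have e1 : `|c2| * A = - (`|c| * B) by lra.
  have e2 : `|c2| * c = - (`|c| * c2) by lra.
  by rewrite e1 e2; ring.
have E z := par _ _ _ _ (conj c1n H1) neg z.
have E' z := par _ _ _ _ (conj c1'n H1') neg' z.
(* Both [b1 / c1] and [b1' / c1'] are the same extremum of [g], since [c1] and [c1'] have the same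
   sign. *)
have eb : c1' * b1 = c1 * b1'.
  have cc : 0 < c1 * c1' by nra.
  pose z := nth 0 S1 0; pose z' := nth 0 S1' 0.
  have /eqP : c1 * g z == b1 by rewrite -E (H1 z).2 mem_nth.
  have /eqP : c1' * g z' == b1' by rewrite -E' (H1' z').2 mem_nth.
  have := (H1 z').1; have := (H1' z).1; rewrite E E' => h1 h2 h3 h4.
  apply/eqP; rewrite eq_le; apply/andP; split.
    case: (ltrgt0P c1) c1n neg => // c1p _ _; first by nra.
    by nra.
  by case: (ltrgt0P c1) c1n neg => // c1p _ _; nra.
move=> z; rewrite -(H1 z).2 -(H1' z).2 E E'.
rewrite -(inj_eq (mulfI c1'n)) eb -[RHS](inj_eq (mulfI c1n)).
by congr (_ == _); ring.
Qed.

Hypothesis regular : hull_complex K = [set vertical_proj @` F | F in facets (lifted_hull f)].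

Lemma regular_supports S : K S -> size S = n.+1 -> exists L c b, supports S L c b.
Proof.
move=> KS sz; have : hull_complex K (hull S : set 'rV[R]_n) by exists S.
by rewrite regular => -[F hF E]; apply: (facet_supports KS _ hF E); rewrite sz.
Qed.

(** If both sides occurred, [supports_opposite] would leave only one simplex on each of them, but
    [S] and two of its translates are three distinct simplices. *)
Lemma supports_same_sign S S' L c b L' c' b' : (0 < n)%N ->
  K S -> K S' -> size S = n.+1 -> size S' = n.+1 ->
  supports S L c b -> supports S' L' c' b' -> 0 < c * c'.
Proof.
move=> n0 KS KS' sz sz' H H'.
rewrite ltNge; apply/negP => cc.
have {}cc : c * c' < 0.
  by rewrite lt_neqAle cc mulf_neq0 //; [case: H | case: H'].
pose e : 'rV[int]_n := const_mx 1.
have e0 k : e *+ k.+1 != 0.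
  apply/eqP => /rowP/(_ (Ordinal n0)); rewrite -scaler_nat !mxE => /eqP.
  by rewrite mulr1 pnatr_eq0.
pose T k := [seq e *+ k.+1 + v | v <- S].
have KT k : K (T k) by exact: (ot_translate hK).
have szT k : size (T k) = n.+1 by rewrite size_map.
have posT k : (0 < size (T k))%N by rewrite szT.
have sup k := regular_supports (KT k) (szT k).
have neT k : ~ T k =i S.
  move=> /(translate_not_self (simplex_uniq hK KS)); rewrite sz => /(_ isT).
  by apply/eqP/e0.
(* no translate of S lies on the side of S, so both do on the other side *)
have signT k Lk ck bk : supports (T k) Lk ck bk -> ck * c < 0.
  move=> Hk; rewrite ltNge; apply/negP => pos; apply: (neT k).
  have {}pos : 0 < ck * c.
    by rewrite lt0r pos mulf_neq0 //; [case: Hk | case: H].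
  apply: (supports_opposite (posT k) _ Hk H H' (mul_sign_trans pos cc) cc).
  by rewrite sz.
have [L1 [c1 [b1 H1]]] := sup 0%N; have [L2 [c2 [b2 H2]]] := sup 1%N.
have E := supports_opposite (posT _) (posT _) H1 H2 H (signT _ _ _ _ H1) (signT _ _ _ _ H2).
have := translate_not_self (simplex_uniq hK (KT 0%N)) (posT 0%N) (z := e).
rewrite -map_comp => /(_ _)/eqP; rewrite (negPf (e0 0%N)) => F; suff: false by [].
apply: F => z; rewrite E; congr (z \in _); apply: eq_map => v /=.
by rewrite addrA -mulrS.
Qed.

End Supports.

Theorem prism_not_regular (R : realType) n (K : seq 'rV[int]_n -> Prop) :
  ordered_triangulation (R := R) K -> cyclic_triangle K ->
  ~ regular_triangulation (hull_complex (R := R) (prism K)).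
Proof.
move=> hK [u [v [t [uv vt tu]]]] [f [_ reg]].
have hP := prism_ordered_triangulation hK.
have [S0 [K0 _ sz0]] := ot_pure hP (ot_single hP 0).
have [L0 [c0 [b0 H0]]] := regular_supports hP reg K0 sz0.
pose h a := f (at_level 1 a) - f (at_level 0 a).
(* the square over the edge a -> a' is cut along (a, 0) -- (a', 1) *)
have edge a a' : K [:: a; a'] -> 0 < c0 * (h a' - h a).
  move=> aa'; have : prism K [:: at_level 0 a; at_level 1 a'].
    by exists 0, [:: a], [:: a'], [:: a; a']; split => //; do 2 constructor.
  move=> /(ot_pure hP)[S [KS /mem_subseq sub sz]].
  have [L [c [b [cn H]]]] := regular_supports hP reg KS sz.
  have cc : 0 < c0 * c.
    by apply: (supports_same_sign hP reg _ K0 KS sz0 sz H0 (conj cn H)); rewrite addn1.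
  have aS : at_level 0 a \in S by apply: sub; rewrite !inE eqxx.
  have a'S : at_level 1 a' \in S by apply: sub; rewrite !inE eqxx orbT.
  have par : at_level 0 a + at_level 1 a' = at_level 1 a + at_level 0 a'.
    by rewrite !at_levelD addrC.
  have neq (a1 a2 : 'rV[int]_n) : at_level 1 a1 != at_level 0 a2.
    apply/eqP => /(congr1 rsubmx)/rowP/(_ 0).
    by rewrite !row_mxKr !mxE eqxx.
  have aa'n : a != a' by have := simplex_uniq hK aa'; rewrite /= inE andbT.
  (* The four corners of a square are affinely dependent by [par], so [S] cannot contain them all.
     Hence the supporting inequality is strict for the sum over the other diagonal, which has the
     same midpoint. *)
  have out : ~~ ((at_level 1 a \in S) && (at_level 0 a' \in S)).
    apply/negP => /andP[bS b'S].
    have [l [d ld]] := simplex_affine_interpolation hP (fun z => (z == at_level 0 a)%:R) KS.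
    have := congr1 (fun z => l (lattice_point z)) par.
    rewrite !lattice_pointD !linearD /= !ld // eqxx.
    rewrite !(negbTE (neq _ _)) (inj_eq (@at_level_inj _ _)) eq_sym (negbTE aa'n).
    by rewrite /=; lra.
  have := congr1 (fun z => dotf L (lattice_point z)) par.
  rewrite !lattice_pointD !linearD /= => parL.
  have [_] := H (at_level 0 a); rewrite aS => /eqP e1.
  have [_] := H (at_level 1 a'); rewrite a'S => /eqP e2.
  have [l1 E1] := H (at_level 1 a); have [l2 E2] := H (at_level 0 a').
  have : 0 < c * (h a' - h a).
    suff : dotf L (lattice_point (at_level 1 a)) + f (at_level 1 a) * c +
      (dotf L (lattice_point (at_level 0 a')) + f (at_level 0 a') * c) < b + b.
      by rewrite /h; lra.
    move: out; rewrite -E1 -E2 negb_and => /orP[ne|ne].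
      by rewrite ltr_leD // lt_neqAle ne.
    by rewrite ler_ltD // lt_neqAle ne.
  by nra.
(* Around the cycle the differences of [h] add up to zero. *)
have := edge _ _ uv; have := edge _ _ vt; have := edge _ _ tu.
by rewrite !mulrBr; lra.
Qed.

(** * The triangulation of dimension four *)

(* The vertex of the unit 4-cube with binary code k, most significant digit
   first. *)
Definition cube_vertex (k : nat) : seq int :=
  [seq (odd (k %/ 2 ^ i) : nat)%:Z | i <- [:: 3; 2; 1; 0]%N].

(* One representative modulo translation of every simplex; its vertices are
   listed so that the differences of later and earlier ones are in
   edge_vectors. *)
Definition cells : seq (seq (seq int)) := [seq map cube_vertex c | c <-
  [:: [:: 0; 2; 4; 7; 14]; [:: 0; 3; 5; 15; 7]; [:: 0; 3; 10; 15; 2];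
      [:: 0; 3; 15; 2; 7]; [:: 0; 4; 15; 7; 14]; [:: 0; 5; 4; 15; 7];
      [:: 0; 5; 12; 4; 15]; [:: 0; 10; 12; 15; 14]; [:: 0; 10; 15; 2; 14];
      [:: 0; 11; 3; 10; 15]; [:: 0; 12; 4; 15; 14]; [:: 0; 15; 2; 7; 14];
      [:: 1; 0; 3; 5; 15]; [:: 1; 0; 11; 3; 15]; [:: 1; 8; 0; 11; 15];
      [:: 1; 8; 11; 13; 15]; [:: 1; 8; 13; 0; 15]; [:: 1; 13; 0; 5; 15];
      [:: 2; 4; 7; 14; 6]; [:: 8; 0; 10; 12; 15]; [:: 8; 0; 11; 10; 15];
      [:: 8; 13; 0; 12; 15]; [:: 9; 1; 8; 11; 13]; [:: 13; 0; 5; 12; 15]]%N].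

Definition edge_vectors : seq (seq int) :=
  [:: [:: 0; 0; 0; -1]; [:: 0; 0; 1; 0]; [:: 0; 0; 1; 1]; [:: 0; 1; -1; 0];
      [:: 0; 1; 0; 0]; [:: 0; 1; 0; 1]; [:: 0; 1; 1; 1]; [:: 1; 0; 0; -1];
      [:: -1; 0; 0; 0]; [:: 1; 0; 1; 0]; [:: 1; 0; 1; 1]; [:: 1; 1; 0; 0];
      [:: -1; -1; 0; -1]; [:: 1; 1; 1; 0]; [:: 1; 1; 1; 1]].

(* The sum of the squares of these nine forms and of the four forms of a frame
   is the quadratic form whose Delaunay triangulation is described by cells. *)
Definition common_forms : seq (seq int) :=
  [:: [:: 1; 0; 0; 0]; [:: 0; 1; 0; 0]; [:: 0; 0; 1; 0]; [:: 0; 0; 0; 1];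
      [:: 1; -1; 0; 0]; [:: 0; 0; 1; -1]; [:: 1; 0; -1; 0]; [:: 0; 1; 0; -1];
      [:: 1; -1; -1; 1]].

(* Three decompositions of the same D4 form as a sum of squares. *)
Definition frames : seq (seq (seq int)) :=
  [:: [:: [:: 0; 0; 0; 1]; [:: 0; 1; -1; 0]; [:: 1; -1; -1; 1]; [:: 1; 0; 0; 0]];
      [:: [:: 0; 0; 1; -1]; [:: 0; 1; 0; 0]; [:: 1; -1; 0; 1]; [:: 1; 0; -1; 0]];
      [:: [:: 0; 0; 1; 0]; [:: 0; 1; 0; -1]; [:: 1; -1; 0; 0]; [:: 1; 0; -1; 1]]].

Definition idot (l a : seq int) : int :=
  l`_0 * a`_0 + l`_1 * a`_1 + l`_2 * a`_2 + l`_3 * a`_3.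

Definition imin (s : seq int) : int :=
  foldr (fun x y => if (x <= y)%R then x else y) (head 0 s) s.

(* On the vertices of a cell c, each of the forms l of c takes only the values
   level c l and level c l + 1. *)
Definition level (c : seq (seq int)) (l : seq int) : int :=
  imin [seq idot l a | a <- c].

Definition narrow (c : seq (seq int)) (l : seq int) : bool :=
  all (fun a => (idot l a == level c l) || (idot l a == level c l + 1)) c.

(** The frame may depend on the cell because all three have the same sum of squares. *)
Definition forms (c : seq (seq int)) : seq (seq int) :=
  common_forms ++ nth [::] frames (find (all (narrow c)) frames).

Definition small_affine : seq (seq int) :=
  let d := [:: 0; 1; -1] in
  flatten [seq flatten [seq flatten [seq flatten [seq [seq [:: i; j; k; l; m]
    | m <- d] | l <- d] | k <- d] | j <- d] | i <- d].

Definition iaff (b a : seq int) : int := idot b a + b`_4.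

(* The barycentric coordinates of the simplex c have coefficients in {-1, 0, 1}. *)
Definition bary_form (c : seq (seq int)) (a : seq int) : seq int :=
  nth [::] small_affine
    (find (fun b => all (fun a' => iaff b a' == (a' == a)%:R) c) small_affine).

Definition lcomb (T : Type) (m : T -> int) (b : T -> seq int) (s : seq T) : seq int :=
  [seq foldr (fun t acc => m t * (b t)`_i + acc) 0 s | i <- [:: 0; 1; 2; 3; 4]%N].

(** What remains of the sum of the products $(l - k)(l - k - 1)$ after removal of the squares $l^2$,
    with $k$ the level of $l$. *)
Definition bump_affine (c : seq (seq int)) : seq int :=
  lcomb (fun=> 1) (fun l => let k := level c l in
    [:: - (2 * k + 1) * l`_0; - (2 * k + 1) * l`_1; - (2 * k + 1) * l`_2;
        - (2 * k + 1) * l`_3; k * (k + 1)]) (forms c).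

Definition cube_walls : seq (seq int) :=
  [:: [:: 1; 0; 0; 0; 0]; [:: 0; 1; 0; 0; 0]; [:: 0; 0; 1; 0; 0]; [:: 0; 0; 0; 1; 0];
      [:: -1; 0; 0; 0; 1]; [:: 0; -1; 0; 0; 1]; [:: 0; 0; -1; 0; 1]; [:: 0; 0; 0; -1; 1]].

Lemma cells_narrow : all (fun c => all (narrow c) (forms c)) cells.
Proof. by vm_compute. Qed.

(** The 16 vertices of the unit cube are enough: the coordinate forms are among the forms of [c] and
    have level 0. *)
Lemma cells_exact : all (fun c => all (fun k =>
  all (fun l => (idot l (cube_vertex k) == level c l) ||
                (idot l (cube_vertex k) == level c l + 1)) (forms c)
  ==> (cube_vertex k \in c)) (iota 0 16)) cells.
Proof. by vm_compute. Qed.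

Lemma bary_formP : all (fun c => all (fun a => all (fun a' =>
  iaff (bary_form c a) a' == (a' == a)%:R) c) c) cells.
Proof. by vm_compute. Qed.

Lemma bary_form_sum : all (fun c =>
  lcomb (fun=> 1) (bary_form c) c == [:: 0; 0; 0; 0; 1]) cells.
Proof. by vm_compute. Qed.

Lemma bary_form_coord : all (fun c => all (fun i =>
  lcomb (fun a => a`_i) (bary_form c) c == [seq (j == i)%:R | j <- iota 0 5]) (iota 0 4)) cells.
Proof. by vm_compute. Qed.

(* A facet of a cell lies on the boundary of the cube, or separates the cell
   from another one whose bump function is smaller on the far side. *)
Lemma cells_walls : (fun bumps => all (fun c => (fun bump => all (fun a =>
    (fun b => (b \in cube_walls) || has (fun m => lcomb (fun p => p.1) (fun p => p.2)
       [:: (1, bump); (m, b)] \in bumps) [:: 2; 4]) (bary_form c a)) c)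
    (bump_affine c)) cells) [seq bump_affine c | c <- cells].
Proof. by vm_compute. Qed.

(** The direction of an edge is read off from its difference vector, so all simplices that share the
    edge agree on it. *)
Lemma cells_order : all (fun c => pairwise (fun a a' =>
   [seq a'`_i - a`_i | i <- iota 0 4] \in edge_vectors) c) cells.
Proof. by vm_compute. Qed.

Lemma edges_asym : all (fun e => [seq - x | x <- e] \notin edge_vectors) edge_vectors.
Proof. by vm_compute. Qed.

Definition vec (a : seq int) : 'rV[int]_4 := \row_i a`_i.

Definition coords (z : 'rV[int]_4) : seq int := [seq z 0 (inord i) | i <- iota 0 4].

Definition cell_complex (s : seq 'rV[int]_4) : Prop :=
  exists c z, c \in cells /\ subseq s [seq z + vec a | a <- c].

Lemma coordsK z : vec (coords z) = z.
Proof.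
apply/rowP => i; rewrite mxE (nth_map 0%N) ?size_iota ?ltn_ord //.
by rewrite nth_iota // add0n inord_val.
Qed.

Lemma vecK a : size a = 4%N -> coords (vec a) = a.
Proof.
move=> sz; apply: (@eq_from_nth _ 0) => [|i]; first by rewrite size_map size_iota sz.
rewrite size_map size_iota => i4.
by rewrite (nth_map 0%N) ?size_iota // nth_iota // add0n mxE inordK.
Qed.

Lemma cells_sizes : all (fun c => (size c == 5) && all (fun a => size a == 4%N) c) cells.
Proof. by vm_compute. Qed.

Lemma coordinate_levels : all (fun c => all (fun l => level c l == 0)
  [:: [:: 1; 0; 0; 0]; [:: 0; 1; 0; 0]; [:: 0; 0; 1; 0]; [:: 0; 0; 0; 1]]) cells.
Proof. by vm_compute. Qed.

Lemma cell_size c : c \in cells -> size c = 5%N.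
Proof. by move=> /(allP cells_sizes)/andP[/eqP]. Qed.

Lemma cell_vertex_size c a : c \in cells -> a \in c -> size a = 4%N.
Proof. by move=> /(allP cells_sizes)/andP[_ /allP H] /H/eqP. Qed.

(** * Quadratic bump functions of the cells *)

Section Forms.
Context {R : realType}.
Implicit Types (l a b : seq int) (x y : 'rV[R]_4) (z : 'rV[int]_4) (c : seq (seq int)).

Definition co x (i : nat) : R := x 0 (inord i).

Definition lform l x : R :=
  (l`_0)%:~R * co x 0 + (l`_1)%:~R * co x 1 + (l`_2)%:~R * co x 2 + (l`_3)%:~R * co x 3.

Definition aform b x : R := lform b x + (b`_4)%:~R.

Lemma lformD l x y : lform l (x + y) = lform l x + lform l y.
Proof. by rewrite /lform /co !mxE; ring. Qed.

Lemma lformZ l (t : R) x : lform l (t *: x) = t * lform l x.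
Proof. by rewrite /lform /co !mxE; ring. Qed.

Lemma lform0 l : lform l 0 = 0.
Proof. by rewrite /lform /co !mxE; ring. Qed.

Lemma lformB l x y : lform l (x - y) = lform l x - lform l y.
Proof. by rewrite /lform /co !mxE; ring. Qed.

Lemma lform_lattice l z : lform l (lattice_point z) = (idot l (coords z))%:~R.
Proof. by rewrite /lform /idot !intrD !rmorphM /= /co !mxE. Qed.

Lemma aform_lattice b z : aform b (lattice_point z) = (iaff b (coords z))%:~R.
Proof. by rewrite /aform lform_lattice -intrD. Qed.

Lemma aform_lcomb (T : Type) (m : T -> int) (b : T -> seq int) (s : seq T) x :
  aform (lcomb m b s) x = \sum_(t <- s) (m t)%:~R * aform (b t) x.
Proof.
rewrite /aform /lform /=; elim: s => [|t s IH]; first by rewrite big_nil /=; ring.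
by rewrite big_cons -IH /= !intrD !rmorphM /=; ring.
Qed.

(** At a lattice point each summand is a product of two consecutive integers, hence nonnegative; it
    vanishes exactly where [l] takes one of its two admissible values. *)
Definition bump c x : R := \sum_(l <- forms c)
  (lform l x - (level c l)%:~R) * (lform l x - (level c l)%:~R - 1).

Definition quad x : R := \sum_(l <- common_forms ++ nth [::] frames 0) lform l x ^+ 2.

Lemma quad_forms c x : c \in cells -> \sum_(l <- forms c) lform l x ^+ 2 = quad x.
Proof.
move=> cc; rewrite /quad /forms !big_cat; congr (_ + _).
(* Every cell has a suitable frame, so the default value of [nth] does not occur. *)
have : (find (all (narrow c)) frames < 3)%N.
  by apply/(allP (_ : all (fun c => find (all (narrow c)) frames < 3)%N cells)); last exact: cc; vm_compute.
by case: (find _ _) => [|[|[|//]]] _; rewrite /= !big_cons big_nil /lform /=; ring.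
Qed.

Lemma bumpE c x : c \in cells -> bump c x = quad x + aform (bump_affine c) x.
Proof.
move=> cc; rewrite -(quad_forms x cc) aform_lcomb -big_split; apply: eq_bigr => l _.
by rewrite /aform /lform /=; ring.
Qed.

Lemma bump_term_ge0 (k m : int) :
  0 <= (k%:~R - m%:~R) * (k%:~R - m%:~R - 1) :> R.
Proof.
have -> : (k%:~R - m%:~R) * (k%:~R - m%:~R - 1) = ((k - m) * (k - m - 1))%:~R :> R.
  by rewrite !(intrM, intrD, intrN) ; ring.
rewrite ler0z; move: (k - m) => j.
by have [j0|j1] := leP j 0; nia.
Qed.

Lemma bump_ge0 c z : 0 <= bump c (lattice_point z).
Proof.
by apply: sumr_ge0 => l _; rewrite lform_lattice; exact: bump_term_ge0.
Qed.

Lemma bump_cell c a : c \in cells -> a \in c -> bump c (lattice_point (vec a)) = 0.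
Proof.
move=> cc ac; rewrite /bump big_seq big1 // => l lc; rewrite lform_lattice.
rewrite vecK ?(cell_vertex_size cc ac) //.
have /allP/(_ l lc)/allP/(_ a ac) := allP cells_narrow c cc.
by case/orP => /eqP->; rewrite ?intrD; ring.
Qed.

Lemma bump_eq0 c z : c \in cells -> bump c (lattice_point z) = 0 ->
  exists2 a, a \in c & z = vec a.
Proof.
move=> cc /eqP; rewrite psumr_eq0 => [/allP H|l _]; last first.
  by rewrite lform_lattice; exact: bump_term_ge0.
have narrow_z l : l \in forms c ->
    (idot l (coords z) == level c l) || (idot l (coords z) == level c l + 1).
  move=> /H/=; rewrite lform_lattice mulf_eq0 subr_eq0 eqr_int -addrA -opprD.
  by rewrite subr_eq0 -[1 in X in _ || X](mulr1z 1) -intrD eqr_int.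
have crd l : l \in [:: [:: 1; 0; 0; 0]; [:: 0; 1; 0; 0]; [:: 0; 0; 1; 0]; [:: 0; 0; 0; 1]] ->
    (idot l (coords z) == 0) || (idot l (coords z) == 1).
  move=> lx; have /allP/(_ l lx)/eqP e := allP coordinate_levels c cc.
  have := narrow_z l; rewrite e; apply; rewrite /forms mem_cat.
  by move: lx; rewrite !inE => /or4P[] ->; rewrite ?orbT.
have [k k16 ez] : exists2 k, (k < 16)%N & coords z = cube_vertex k.
  rewrite /coords /=; set z0 := z _ _; set z1 := z _ _; set z2 := z _ _; set z3 := z _ _.
  have := crd [:: 1; 0; 0; 0] isT; have := crd [:: 0; 1; 0; 0] isT.
  have := crd [:: 0; 0; 1; 0] isT; have := crd [:: 0; 0; 0; 1] isT.
  rewrite /idot /coords /= -/z0 -/z1 -/z2 -/z3 !(mul0r, mul1r, add0r, addr0).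
  move=> /orP[]/eqP-> /orP[]/eqP-> /orP[]/eqP-> /orP[]/eqP->;
    by [exists 0%N|exists 1%N|exists 2%N|exists 3%N|exists 4%N|exists 5%N
       |exists 6%N|exists 7%N|exists 8%N|exists 9%N|exists 10%N|exists 11%N
       |exists 12%N|exists 13%N|exists 14%N|exists 15%N].
exists (cube_vertex k); last by rewrite -ez coordsK.
have /allP/(_ k) := allP cells_exact c cc; rewrite mem_iota k16 => /(_ isT)/implyP.
by apply; apply/allP => l /narrow_z; rewrite ez.
Qed.

End Forms.

(** If the heads of the lists differed, each would be related to the other. *)
Lemma pairwise_asym_eq (T : eqType) (r : rel T) (s s' : seq T) :
  (forall u v, r u v -> ~~ r v u) -> pairwise r s -> pairwise r s' ->
  s =i s' -> s = s'.
Proof.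
move=> asym; elim: s s' => [|u s IH] [|v s'] //=.
- by move=> _ _ /(_ v); rewrite mem_head.
- by move=> _ _ /(_ u); rewrite mem_head.
case/andP=> /allP us ps /andP[/allP vs ps'] E.
have irr t : ~~ r t t by apply/negP => h; move: (asym _ _ h); rewrite h.
have uv : u = v.
  have := mem_head u s; rewrite E inE => /predU1P[//|us'].
  have := mem_head v s'; rewrite -E inE => /predU1P[->//|vs0].
  by move: (asym _ _ (us _ vs0)); rewrite (vs _ us').
subst v; congr (_ :: _); apply: IH => // t; have := E t; rewrite !inE.
have [-> _|//] := eqVneq t u.
by rewrite (contraNF (us u) (irr u)) (contraNF (vs u) (irr u)).
Qed.

Lemma exists_min (R : realType) (T : eqType) (s : seq T) (F : T -> R) :
  s != [::] -> exists2 t, t \in s & forall t', t' \in s -> F t <= F t'.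
Proof.
elim: s => [//|u s IH] _; have [->|/IH[t ts tmin]] := eqVneq s [::].
  by exists u; [rewrite mem_head | move=> t'; rewrite inE => /eqP->].
have [ut|tu] := leP (F u) (F t).
  exists u; first exact: mem_head.
  move=> t'; rewrite inE => /predU1P[->//|/tmin]; exact: le_trans.
exists t; first by rewrite inE ts orbT.
by move=> t'; rewrite inE => /predU1P[->|/tmin//]; exact: ltW.
Qed.

Lemma sum_same_key (V : nmodType) (T : eqType) (s : seq (T * V)) p :
  uniq (unzip1 s) -> p \in s -> \sum_(q <- s | q.1 == p.1) q.2 = p.2.
Proof.
elim: s => [//|q s IH] /= /andP[qs us]; rewrite inE big_cons.
case/predU1P => [->|ps].
  rewrite eqxx big_seq_cond big1 ?addr0 // => t /andP[ts /eqP e].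
  by case/negP: qs; rewrite -e map_f.
by rewrite ifN ?IH //; apply: contraNneq qs => ->; rewrite map_f.
Qed.

(** * Weighted sums of the bump functions *)

Section Expectation.
Context {R : realType}.
Implicit Types (w : seq ('rV[int]_4 * R)) (g : 'rV[R]_4 -> R) (x y : 'rV[R]_4).

Definition expectation w g : R := \sum_(p <- w) p.2 * g (lattice_point p.1).

Lemma expectation_lforms w (fs : seq (seq int)) (al be : seq int -> R) :
  expectation w (fun x => \sum_(l <- fs) (al l * lform l x + be l)) =
  \sum_(l <- fs) (al l * lform l (barycenter w) + be l * mass w).
Proof.
rewrite /expectation; elim: w => [|p w IH].
  rewrite big_nil big1 // => l _.
  by rewrite barycenter_nil mass_nil lform0 !mulr0 addr0.
rewrite big_cons {}IH barycenter_cons mass_cons mulr_sumr -big_split.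
by apply: eq_bigr => l _ /=; rewrite lformD lformZ; ring.
Qed.

(* Every translate of a bump differs from quad by an affine function. *)
Lemma expectation_bump w w' c y : c \in cells ->
  mass w = mass w' -> barycenter w = barycenter w' ->
  expectation w (fun x => bump c (x - y)) - expectation w quad =
  expectation w' (fun x => bump c (x - y)) - expectation w' quad.
Proof.
move=> cc mw bw.
(* Translation by [y] shifts the level of [l] by the value of [l] at [y]. *)
pose k l := lform l y + (level c l)%:~R.
have E u : expectation u (fun x => bump c (x - y)) - expectation u quad =
    expectation u (fun x => \sum_(l <- forms c)
      (- (k l *+ 2 + 1) * lform l x + k l * (k l + 1))).
  rewrite /expectation -sumrB; apply: eq_bigr => p _; rewrite -mulrBr.
  rewrite -(quad_forms _ cc) -sumrB; congr (_ * _); apply: eq_bigr => l _.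
  by rewrite lformB /k; ring.
by rewrite !E !expectation_lforms mw bw.
Qed.

Lemma expectation_aform w b y : mass w = 1 ->
  expectation w (fun x => aform b (x - y)) = aform b (barycenter w - y).
Proof.
move=> mw; have := expectation_lforms w [:: b] (fun=> 1)
  (fun l => (l`_4)%:~R - lform l y).
rewrite big_seq1 mw mulr1 mul1r /aform lformB => E; rewrite -addrA [- _ + _]addrC -E.
apply: eq_bigr => p _; rewrite big_seq1 lformB; congr (_ * _); ring.
Qed.

Lemma expectation_eq0 w g : positive w ->
  (forall p, p \in w -> 0 <= g (lattice_point p.1)) -> expectation w g = 0 ->
  forall p, p \in w -> g (lattice_point p.1) = 0.
Proof.
elim: w => [//|q w IH] /= /andP[q0 pw] g0; rewrite /expectation big_cons.
have gq : 0 <= g (lattice_point q.1) by apply: g0; rewrite mem_head.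
have g0' p : p \in w -> 0 <= g (lattice_point p.1).
  by move=> pw'; apply: g0; rewrite inE pw' orbT.
have s0 : 0 <= \sum_(p <- w) p.2 * g (lattice_point p.1).
  rewrite big_seq sumr_ge0 // => p pw'.
  by rewrite mulr_ge0 ?g0' // ltW //; move/allP: pw; apply.
move/eqP; rewrite paddr_eq0 ?mulr_ge0 ?(ltW q0) // mulf_eq0 (gt_eqF q0) /=.
by case/andP=> /eqP gq0 /eqP gw0 p; rewrite inE => /predU1P[->//|]; exact: IH.
Qed.

End Expectation.

Definition edge_rel (u v : 'rV[int]_4) := coords (v - u) \in edge_vectors.

Lemma edge_rel_asym u v : edge_rel u v -> ~~ edge_rel v u.
Proof.
rewrite /edge_rel => /(allP edges_asym).
suff -> : coords (u - v) = [seq - x | x <- coords (v - u)] by [].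
by rewrite -(opprB v u) /coords -map_comp; apply: eq_map => i /=; rewrite mxE.
Qed.

Lemma cell_complex_pairwise s : cell_complex s -> pairwise edge_rel s.
Proof.
move=> [c [z [cc sub]]]; apply: subseq_pairwise sub _.
rewrite pairwise_map; move: (allP cells_order c cc); apply: sub_pairwise => a a' H.
suff E : coords (z + vec a' - (z + vec a)) = [seq a'`_i - a`_i | i <- iota 0 4].
  by rewrite /= /edge_rel E.
rewrite opprD addrACA subrr add0r /coords; apply/eq_in_map => i.
by rewrite mem_iota => /andP[_ i4]; rewrite !mxE inordK.
Qed.

(** * The cells form an ordered triangulation *)

Section CellComplex.
Context {R : realType}.
Implicit Types (w : seq ('rV[int]_4 * R)) (x : 'rV[R]_4).

(** The bumps of the two translated cells differ by an affine function, whose expectation is the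
    same for [w] and [w']. Each bump has expectation zero on its own list and a nonnegative one on
    the other list, so all four vanish, and [w'] is carried by the zeros of the first bump. *)
Lemma cell_complex_same_cell x w w' : 
  represents cell_complex x w -> represents cell_complex x w' ->
  exists c z, c \in cells /\
    forall p, p \in w ++ w' -> exists2 a, a \in c & p.1 = z + vec a.
Proof.
case=> [[c [z [cc sub]]] pw mw bw] [[c' [z' [cc' sub']]] pw' mw' bw'].
have inc k (v : seq ('rV[int]_4 * R)) y p : subseq (unzip1 v) [seq y + vec a | a <- k] ->
    p \in v -> exists2 a, a \in k & p.1 = y + vec a.
  move=> sb pv; have /mapP[a ak ->] := mem_subseq sb (map_f _ pv).
  by exists a.
exists c, z; split=> // p; rewrite mem_cat => /orP[|]; first exact: inc.
pose g k (y : 'rV[int]_4) (x : 'rV[R]_4) := bump k (x - lattice_point y).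
have gE k y v : g k y (lattice_point v) = bump k (lattice_point (v - y)).
  by rewrite /g /lattice_point map_mxB.
have g0 k y v : 0 <= g k y (lattice_point v) by rewrite gE bump_ge0.
have E0 k y v : k \in cells -> subseq (unzip1 v) [seq y + vec a | a <- k] ->
    expectation v (g k y) = 0.
  move=> kc sb; rewrite /expectation big_seq big1 // => q qv.
  have [a ak ->] := inc _ _ _ _ sb qv.
  by rewrite gE addrC addKr bump_cell // mulr0.
have Ege v k y : positive v -> 0 <= expectation v (g k y).
  move=> pv; rewrite /expectation big_seq sumr_ge0 // => q qv.
  by rewrite mulr_ge0 // ltW //; move/allP: pv; apply.
have e1 := expectation_bump (lattice_point z) cc (etrans mw (esym mw')) (etrans bw (esym bw')).
have e2 := expectation_bump (lattice_point z') cc' (etrans mw (esym mw')) (etrans bw (esym bw')).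
have := Ege w c' z' pw; have := Ege w' c z pw'.
have := E0 _ _ _ cc sub; have := E0 _ _ _ cc' sub'.
rewrite -![expectation _ (fun x => _)]/(expectation _ (g _ _)) in e1 e2 *.
move=> h1 h2 h3 h4; have h5 : expectation w' (g c z) = 0 by lra.
move=> pw''; have := expectation_eq0 pw' (fun q _ => g0 c z q.1) h5 pw''.
rewrite gE => /(bump_eq0 cc)[a ac e]; exists a => //.
by rewrite -e addrC subrK.
Qed.

(** Within a common cell the weights are the barycentric coordinates of [x], so both lists have the
    same vertices; [edge_rel] forces their order. *)
Lemma cell_complex_unique x w w' :
  represents cell_complex x w -> represents cell_complex x w' -> w = w'.
Proof.
move=> rw rw'; have [c [z [cc sup]]] := cell_complex_same_cell rw rw'.
have wE v : represents cell_complex x v -> {subset v <= w ++ w'} ->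
    v = [seq (u, aform (bary_form c (coords (u - z))) (x - lattice_point z)) | u <- unzip1 v]
    /\ forall a, a \in c ->
      (z + vec a \in unzip1 v) = (0 < aform (bary_form c a) (x - lattice_point z)).
  move=> [Kv pv mv bv] sub.
  have uv : uniq (unzip1 v).
    apply: (pairwise_uniq (r := edge_rel)); last exact: cell_complex_pairwise.
    by move=> u; apply/negP => h; move: (edge_rel_asym h); rewrite h.
  have wt a : a \in c -> aform (bary_form c a) (x - lattice_point z) =
      \sum_(p <- v | p.1 == z + vec a) p.2.
    move=> ac; rewrite -bv -(expectation_aform _ _ mv) [RHS]big_mkcond.
    rewrite /expectation [LHS]big_seq [RHS]big_seq; apply: eq_bigr => p /sub/sup[a' a'c ->].
    have -> : lattice_point (z + vec a') - lattice_point z = lattice_point (vec a') :> 'rV[R]_4.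
      by rewrite lattice_pointD addrC addKr.
    rewrite aform_lattice vecK ?(cell_vertex_size cc a'c) //.
    have /allP/(_ a ac)/allP/(_ a' a'c)/eqP -> := allP bary_formP c cc.
    rewrite (inj_eq (addrI _)); have [->|ne] := eqVneq a' a.
      by rewrite eqxx mulr1.
    case: eqP => [e|_]; last by rewrite mulr0.
    case/negP: ne; apply/eqP; rewrite -(vecK (cell_vertex_size cc a'c)) e.
    by rewrite vecK // (cell_vertex_size cc ac).
  have wt1 p := @sum_same_key _ _ v p uv.
  split.
    rewrite -map_comp -[LHS]map_id; apply/eq_in_map => p pv' /=.
    have [a ac e] := sup _ (sub _ pv').
    have -> : coords (p.1 - z) = a.
      by rewrite e [z + _]addrC addrK vecK // (cell_vertex_size cc ac).
    by rewrite wt // -e wt1 //; case: (p).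
  move=> a ac; rewrite wt //; apply/idP/idP => [/mapP[p pv' e]|].
    by rewrite e wt1 //; move/allP: pv; apply.
  apply: contraTT => no; rewrite big_seq_cond big1 ?ltxx // => p /andP[pv' /eqP e].
  by case/negP: no; rewrite -e map_f.
have [|E1 m1] := wE w rw; first by move=> p h; rewrite mem_cat h.
have [|E2 m2] := wE w' rw'; first by move=> p h; rewrite mem_cat h orbT.
suff e : unzip1 w = unzip1 w' by rewrite E1 E2 e.
apply: (pairwise_asym_eq edge_rel_asym).
- by apply: cell_complex_pairwise; case: rw.
- by apply: cell_complex_pairwise; case: rw'.
move=> u; apply/idP/idP => /mapP[p pw e].
  have [|a ac e'] := sup p; first by rewrite mem_cat pw.
  by rewrite e e' m2 // -m1 // -e' map_f.
have [|a ac e'] := sup p; first by rewrite mem_cat pw orbT.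
by rewrite e e' m1 // -m2 // -e' map_f.
Qed.


(** After reduction to the unit cube, a cell whose bump is least at the point contains it. *)
Lemma cell_complex_cover x : exists w, represents cell_complex x w.
Proof.
pose z : 'rV[int]_4 := \row_i Num.floor (x 0 i).
pose y : 'rV[R]_4 := x - lattice_point z.
have y01 i : 0 <= co y i <= 1.
  rewrite /co /y !mxE; have := floor_itv (x 0 (inord i)); rewrite intrD.
  by lra.
have [//|c cc cmin] := @exists_min R _ cells (fun c => bump c y).
pose be a := aform (bary_form c a) y.
have be0 a : a \in c -> 0 <= be a.
  move=> ac; rewrite /be.
  (* A coordinate that is a wall of the cube is nonnegative on the cube. Otherwise some cell has as
     its bump that of [c] plus [m] times the coordinate, and minimality of [c] gives the sign. *)
  have /allP/(_ a ac)/orP[|/hasP[m m24 /mapP[c' cc']]] := allP cells_walls c cc.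
    have := y01 0%N; have := y01 1%N; have := y01 2%N; have := y01 3%N.
    rewrite !inE /aform /lform => h0 h1 h2 h3.
    by do !case/predU1P => [->|]; rewrite /=; [lra..|move=> /eqP->; rewrite /=; lra].
  move=> /(congr1 (fun b => aform b y)).
  rewrite aform_lcomb !big_cons big_nil /= => E.
  have := cmin c' cc'; rewrite !bumpE // -E; move: m24; rewrite !inE.
  by case/orP => /eqP->; lra.
have lc (m : seq int -> int) (b : seq int) :
    lcomb m (bary_form c) c = b -> \sum_(a <- c) (m a)%:~R * be a = aform b y.
  by move=> <-; rewrite aform_lcomb.
have drop (V : nmodType) (F : seq int -> V) :
    (forall a, a \in c -> be a = 0 -> F a = 0) ->
    \sum_(a <- c | 0 < be a) F a = \sum_(a <- c) F a.
  move=> F0; rewrite [LHS]big_mkcond [LHS]big_seq [RHS]big_seq.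
  apply: eq_bigr => a ac /=; case: ltP => // ba.
  by rewrite F0 //; apply/eqP; rewrite eq_le ba be0.
have be1 : \sum_(a <- c) be a = 1.
  have /eqP/(lc (fun=> 1)) := allP bary_form_sum c cc.
  by under eq_bigr do rewrite mul1r; move=> ->; rewrite /aform /lform /=; ring.
exists [seq (z + vec a, be a) | a <- c & 0 < be a]; split.
- exists c, z; split => //; rewrite /unzip1 -map_comp.
  exact: (map_subseq (fun a => z + vec a) (filter_subseq _ _)).
- by rewrite /positive all_map; apply/allP => a; rewrite mem_filter => /andP[].
- by rewrite /mass big_map big_filter drop.
rewrite /barycenter big_map big_filter drop => [|a _ ->]; last by rewrite scale0r.
under eq_bigr do rewrite lattice_pointD scalerDr.
rewrite big_split /= -scaler_suml be1 scale1r -[RHS](subrK (lattice_point z)) addrC.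
congr (_ + _); apply/rowP => i; rewrite summxE -/y.
have /allP/(_ (nat_of_ord i)) := allP bary_form_coord c cc.
rewrite mem_iota ltn_ord => /(_ isT)/eqP/(lc (fun a => a`_i)) E.
transitivity (\sum_(a <- c) (a`_i)%:~R * be a).
  by apply: eq_bigr => a _; rewrite !mxE mulrC.
rewrite E /aform /lform /co -[in RHS](inord_val i).
by case: i {E} => [[|[|[|[|//]]]] /= _]; rewrite /=; ring.
Qed.

Theorem cell_complex_triangulation : ordered_triangulation (R := R) cell_complex.
Proof.
split.
- by move=> s s' sub [c [z [cc sub']]]; exists c, z; split=> //; exact: subseq_trans sub'.
- move=> z s [c [z' [cc sub]]]; exists c, (z + z'); split=> //.
  have := map_subseq (fun v => z + v) sub; rewrite -map_comp.
  by under [X in subseq _ X]eq_map do rewrite /= addrA.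
- move=> z; have c0 : head [::] cells \in cells by rewrite mem_head.
  exists (head [::] cells), z; split=> //; rewrite sub1seq.
  apply/mapP; exists (cube_vertex 0) => //.
  rewrite -[LHS]addr0; congr (_ + _); apply/rowP => i.
  by rewrite !mxE; case: i => [[|[|[|[|//]]]] ?].
- move=> s [c [z [cc sub]]]; exists [seq z + vec a | a <- c]; split=> //.
    by exists c, z.
  by rewrite size_map (cell_size cc).
- exact: cell_complex_cover.
- exact: cell_complex_unique.
Qed.

End CellComplex.

(** The edge vectors $(0,1,-1,0)$, $(1,0,1,1)$ and $(-1,-1,0,-1)$ add up to zero; each of the three
    edges is found in a different cell. *)
Lemma cell_complex_cyclic : cyclic_triangle cell_complex.
Proof.
exists (vec (cube_vertex 2)), (vec (cube_vertex 4)), (vec (cube_vertex 15)).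
have edge c a a' : c \in cells -> subseq [:: a; a'] c -> cell_complex [:: vec a; vec a'].
  move=> cc sub; exists c, 0; split=> //.
  by rewrite (eq_map (fun a => add0r (vec a))); exact: (map_subseq vec sub).
split.
- by apply: (edge (nth [::] cells 0)).
- by apply: (edge (nth [::] cells 4)).
- by apply: (edge (nth [::] cells 2)).
Qed.

Lemma cyclic_triangulation (R : realType) (n : nat) : (4 <= n)%N ->
  exists2 K : seq 'rV[int]_n -> Prop,
    ordered_triangulation (R := R) K & cyclic_triangle K.
Proof.
elim: n => [//|n IH]; rewrite leq_eqVlt => /predU1P[<-|/IH[K hK cK]].
  by exists cell_complex; [exact: cell_complex_triangulation | exact: cell_complex_cyclic].
rewrite -(addn1 n); exists (prism K).
  exact: prism_ordered_triangulation.
exact: prism_cyclic_triangle.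
Qed.

Theorem theorem7p4 (R : realType) (n : nat) (hn : (5 <= n)%N) :
  exists T : set (set 'rV[R]_n),
    periodic_triangulation T /\ ~ regular_triangulation T.
Proof.
(* The last dimension is spent on the prism that turns the cycle into non-regularity, whence 5
   rather than 4. *)
case: n hn => [//|n] hn; have [K hK cK] := cyclic_triangulation R hn.
rewrite -(addn1 n); exists (hull_complex (prism K)); split.
  exact: hull_complex_periodic (prism_ordered_triangulation hK).
exact: prism_not_regular.
Qed.
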